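(* Let $1\le p,q\le\infty$. For all integers $1\le n\le m$ the following holds: 1. If $2\le q\le p<\infty$, then $\Gamma_n(B_p^m,B_q^m)\sim_{p,q} n^{1/2}m^{1/p-1/q}$. 2. If $q\le p\le2$, then $\Gamma_n(B_p^m,B_q^m)\sim_{p,q} n^{1-1/p}m^{1/p-1/q}$. 3. If $p\le q$ and $1\le p\le2$, then $\Gamma_n(B_p^m,B_q^m)\sim_{p,q} n^{1-1/q}$. 4. If $p\le q$ and $2<p<\infty$, then $\Gamma_n(B_p^m,B_q^m)\sim_{p,q} n^{1/2+1/p-1/q}$.
   Context: $a\sim_{p,q}b$ means $c_{p,q}b\le a\le C_{p,q}b$ with constants $c_{p,q},C_{p,q}>0$ depending only on $p,q$ (in particular not on $n,m$). $B_p^m$ is the unit ball of $\ell_p^m$, i.e. of $\mathbb{R}^m$ with the $\ell_p$ norm; $1/\infty=0$. A ball in $\mathbb{R}^m$ is a bounded, convex, symmetric set with nonempty interior; $\|\cdot\|_K$ is the norm with unit ball $K$. For balls $K,L\subset\mathbb{R}^m$ and $n\le m$, $\Gamma_n(K,L)=\inf\|A\|\,\|B\|$, where the infimum is over all $n$-dimensional subspaces $E\subset\mathbb{R}^m$ and all linear operators $B:(E,\|\cdot\|_{L\cap E})\to\ell_1^n$, $A:\ell_1^n\to(E,\|\cdot\|_{K\cap E})$ such that $AB=\mathrm{id}_E$ (operator norms with respect to the indicated norms). *)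

(* Defs.v *)
From HB Require Import structures.
From mathcomp Require Import all_boot all_order all_algebra.
From mathcomp Require Import all_classical all_reals all_analysis.

Set Implicit Arguments.
Unset Strict Implicit.
Unset Printing Implicit Defensive.

Import Order.TTheory GRing.Theory Num.Theory.

Local Open Scope classical_set_scope.
Local Open Scope ring_scope.

(* The exponents lie in \bar R; the value at -oo is junk. *)
Definition lpnorm (R : realType) (m : nat) (p : \bar R) (x : 'rV[R]_m) : R :=
  match p with
  | r%:E => (\sum_(i < m) `|x ord0 i| `^ r) `^ r^-1
  | +oo%E => \big[Num.max/0]_(i < m) `|x ord0 i|
  | -oo%E => 0
  end.

Definition lpball (R : realType) (m : nat) (p : \bar R) : set 'rV[R]_m :=
  [set x | lpnorm p x <= 1].

(* 1/p as a real number; the library's inverse on \bar R gives 1/oo = 0. *)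
Definition invexp (R : realType) (p : \bar R) : R := fine (p^-1)%E.

(* Minkowski functional: it is the norm with unit ball K when K is bounded,
   convex, symmetric and has nonempty interior. *)
Definition gauge_norm (R : realType) (V : lmodType R) (K : set V) (x : V) : R :=
  inf [set t : R | 0 < t /\ exists2 y, K y & x = t *: y].

(* The set K `&` E, seen as a subset of the vector space E. *)
Definition section_of (R : realType) (m : nat) (K : set 'rV[R]_m)
    (E : {vspace 'rV[R]_m}) : set (subvs_of E) :=
  [set v | K (vsval v)].

(* Extended-real valued, so that no boundedness assumption is hidden. *)
Definition opnorm (R : realType) (U V : Type) (normU : U -> R) (normV : V -> R)
    (f : U -> V) : \bar R :=
  ereal_sup [set (normV (f x))%:E | x in [set x : U | normU x <= 1]].

(* Intended for balls K and L: bounded, convex, symmetric sets with nonempty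
   interior. *)
Definition Gamma (R : realType) (n m : nat) (K L : set 'rV[R]_m) : \bar R :=
  ereal_inf [set r : \bar R |
    exists (E : {vspace 'rV[R]_m})
           (B : 'Hom(subvs_of E, 'rV[R]_n)) (A : 'Hom('rV[R]_n, subvs_of E)),
      [/\ \dim E = n, (A \o B)%VF = \1%VF &
          r = (opnorm (@lpnorm R n 1%:E) (gauge_norm (section_of K (E := E))) A *
               opnorm (gauge_norm (section_of L (E := E))) (@lpnorm R n 1%:E) B)%E]].

(* The constants c and C do not depend on n and m. *)
Definition equiv_nm (R : realType) (a : nat -> nat -> \bar R)
    (b : nat -> nat -> R) : Prop :=
  exists c C : R, [/\ 0 < c, 0 < C &
    forall n m : nat, (1 <= n)%N -> (n <= m)%N ->
      ((c * b n m)%:E <= a n m)%E /\ (a n m <= (C * b n m)%:E)%E].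

(* Main.v *)
(* Factoring id_E through l_1^n amounts to choosing n independent vectors x_i in
   the unit ball of l_p^m; Gamma_n is then the infimum over such choices of the
   supremum over t of |t|_1 / |sum_i t_i x_i|_q.

   Upper bounds exhibit the x_i: unit vectors, normalized indicators of disjoint
   blocks of length m %/ n, or rows of the discrete cosine transform, which are
   orthogonal with bounded entries.

   Lower bounds exhibit t for given x_i. Random signs and Khintchine's inequality
   suffice when q <= max(p, 2). Otherwise t is half the difference of two sign
   vectors (a partial colouring, as in the entropy method of Beck and Spencer):
   the coordinates of sum_i e_i x_i are rounded to cells of width D, a code for
   the cells whose average length is a small multiple of n shows that few cells
   contain at least half of all sign vectors e, hence some cell contains two sign
   vectors at Hamming distance at least n/64. Their difference is O(D) in l_oo
   and O(n^(1/2)) in l_p, and l_q is obtained by interpolation. *)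
Require Import Defs.
From mathcomp Require Import all_boot all_order all_algebra.
From mathcomp Require Import all_classical all_reals all_analysis.
From mathcomp Require Import ring lra zify.

Set Implicit Arguments.
Unset Strict Implicit.
Unset Printing Implicit Defensive.

Import Order.TTheory GRing.Theory Num.Theory.

Local Open Scope classical_set_scope.
Local Open Scope ring_scope.

(** * Elementary inequalities for real powers and exponentials *)

Section Inequalities.
Context {R : realType}.
Implicit Types (x y r s : R).

Lemma ler_powR2 r x y : 0 <= r -> 0 <= x -> x <= y -> x `^ r <= y `^ r.
Proof.
move=> r0 x0 xy; apply: ge0_ler_powR => //; rewrite nnegrE //.
exact: le_trans xy.
Qed.

Lemma powRK r x : r != 0 -> 0 <= x -> (x `^ r) `^ r^-1 = x.
Proof. by move=> r0 x0; rewrite -powRrM divff // powRr1. Qed.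

Lemma powRVK r x : r != 0 -> 0 <= x -> (x `^ r^-1) `^ r = x.
Proof. by move=> r0 x0; rewrite -powRrM mulVf // powRr1. Qed.

Lemma invr_powR r x : 0 <= x -> x^-1 `^ r = (x `^ r)^-1.
Proof. by move=> x0; rewrite -powR_inv1 // -powRrM mulN1r powRN. Qed.

Lemma bernoulli_powR s y : 1 <= s -> 0 <= y -> 1 + s * (y - 1) <= y `^ s.
Proof.
move=> s1 y0; have s0 : 0 < s by exact: lt_le_trans s1.
have [->|sN1] := eqVneq s 1; first by rewrite powRr1 //; lra.
(* Young's inequality for the product [y * 1]. *)
have s1' : 0 < s - 1 by rewrite subr_gt0 lt_neqAle eq_sym sN1.
have := @conjugate_powR _ y 1 s (s / (s - 1)) y0 ler01 s0 (divr_gt0 s0 s1').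
rewrite powR1 mulr1 invf_div => /(_ _) H.
have /H : s^-1 + (s - 1) / s = 1 by field; rewrite gt_eqF.
rewrite mul1r => {}H.
have : s * y <= s * (y `^ s / s + (s - 1) / s) by rewrite ler_pM2l.
have -> : s * (y `^ s / s + (s - 1) / s) = y `^ s + (s - 1).
  by field; rewrite gt_eqF.
by lra.
Qed.

(* Bernoulli's inequality at [y i] divided by the mean of [y], summed over [i]. *)
Lemma powR_mean n s (y : 'I_n -> R) : 1 <= s -> (forall i, 0 <= y i) ->
  (\sum_i y i) `^ s <= n%:R `^ (s - 1) * \sum_i y i `^ s.
Proof.
move=> s1 y0; have s0 : 0 < s by exact: lt_le_trans s1.
have sy0 : 0 <= \sum_i y i by exact: sumr_ge0.
have [Y0|Yneq0] := eqVneq (\sum_i y i) 0.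
  rewrite Y0 powR0 ?gt_eqF // mulr_ge0 ?powR_ge0 //.
  by apply: sumr_ge0 => i _; exact: powR_ge0.
have n0 : (0 < n)%N.
  by case: n y y0 sy0 Yneq0 => // y; rewrite big_ord0 eqxx.
have nR0 : 0 < n%:R :> R by rewrite ltr0n.
set Y := \sum_i y i in sy0 Yneq0 *.
have Y0 : 0 < Y by rewrite lt_neqAle eq_sym Yneq0.
have c0 : 0 < Y / n%:R by rewrite divr_gt0.
have key : \sum_i (1 + s * (y i / (Y / n%:R) - 1)) <=
    \sum_i y i `^ s / (Y / n%:R) `^ s.
  apply: ler_sum => i _; rewrite -invr_powR ?(ltW c0) //.
  rewrite -powRM ?invr_ge0 ?(ltW c0) //.
  by apply: bernoulli_powR; rewrite ?divr_ge0 // ltW.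
have lhs : \sum_i (1 + s * (y i / (Y / n%:R) - 1)) = n%:R.
  rewrite big_split /= sumr_const card_ord -mulr_sumr sumrB -mulr_suml.
  rewrite sumr_const card_ord -/Y -[RHS]addr0; congr (_ + _).
  by field; rewrite (gt_eqF nR0) Yneq0.
move: key; rewrite lhs -mulr_suml ler_pdivlMr ?powR_gt0 //.
rewrite powRM ?invr_ge0 ?ler0n //.
rewrite invr_powR ?ler0n //.
have -> : n%:R * (Y `^ s / n%:R `^ s) = Y `^ s / n%:R `^ (s - 1).
  by rewrite powRB ?(gt_eqF nR0) ?implybT // powRr1 ?ler0n // invf_div mulrCA.
by rewrite ler_pdivrMr ?powR_gt0 // mulrC.
Qed.

(** With [Y] the total, each nonzero ratio [y i / Y] lies in ]0, 1] and so is at most its [s]-th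
    power, while the ratios sum to 1. *)
Lemma powR_sum_le n s (y : 'I_n -> R) : 0 < s <= 1 -> (forall i, 0 <= y i) ->
  (\sum_i y i) `^ s <= \sum_i y i `^ s.
Proof.
move=> /andP[s0 s1] y0.
have sy0 : 0 <= \sum_i y i by exact: sumr_ge0.
have [->|Yneq0] := eqVneq (\sum_i y i) 0.
  by rewrite powR0 ?gt_eqF //; apply: sumr_ge0 => i _; exact: powR_ge0.
set Y := \sum_i y i in sy0 Yneq0 *.
have Y0 : 0 < Y by rewrite lt_neqAle eq_sym Yneq0.
have yY i : y i <= Y.
  by rewrite /Y (bigD1 i) //= lerDl; apply: sumr_ge0.
have -> : Y `^ s = \sum_i y i / Y * Y `^ s.
  by rewrite -!mulr_suml divff // mul1r.
apply: ler_sum => i _.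
have [yi0|yi0] := eqVneq (y i) 0; first by rewrite yi0 !mul0r powR_ge0.
have yi_gt0 : 0 < y i by rewrite lt_neqAle eq_sym yi0 y0.
have -> : y i `^ s = (y i / Y) `^ s * Y `^ s.
  by rewrite -powRM ?divr_ge0 // divfK.
apply: ler_wpM2r; first exact: powR_ge0.
apply: ger1_powR => //; rewrite divr_gt0 //=.
by rewrite ler_pdivrMr // mul1r.
Qed.

Lemma sum_powR_le n s (y : 'I_n -> R) : 1 <= s -> (forall i, 0 <= y i) ->
  \sum_i y i `^ s <= (\sum_i y i) `^ s.
Proof.
move=> s1 y0; have s0 : 0 < s by exact: lt_le_trans s1.
have S0 : 0 <= \sum_i y i `^ s by apply: sumr_ge0 => i _; exact: powR_ge0.
rewrite -[leLHS](powRVK (lt0r_neq0 s0)) //.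
apply: ler_powR2; [exact: ltW|exact: powR_ge0|].
apply: le_trans (powR_sum_le _ _) _.
- by rewrite invr_gt0 s0 invf_le1.
- by move=> i; exact: powR_ge0.
- by under eq_bigr do rewrite powRK ?gt_eqF //.
Qed.

(** The [r]-th power of [x / r <= expR (x / r)]; it reduces moments to exponential moments. *)
Lemma powR_le_expR r x : 0 < r -> 0 <= x -> x `^ r <= r `^ r * expR x.
Proof.
move=> r0 x0; have -> : x = r * (x / r) by field; rewrite gt_eqF.
rewrite powRM ?divr_ge0 ?(ltW r0) //; apply: ler_wpM2l; first exact: powR_ge0.
rewrite [r * _]mulrC expRM; apply: ler_powR2; rewrite ?divr_ge0 ?(ltW r0) //.
by apply: le_trans (expR_ge1Dx _); rewrite lerDr.
Qed.

(** A sub-Gaussian bound, with an exponent generous enough for an elementary proof. For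
    [0 <= x <= 1/2], the bounds [1 / (1 - x)] and [1 / (1 + x)] of the two exponentials add up to
    [2 / (1 - x ^+ 2)]; beyond, [x <= 2 * x ^+ 2]. *)
Lemma cosh_le x : expR x + expR (- x) <= 2 * expR (2 * x ^+ 2).
Proof.
wlog x0 : x / 0 <= x.
  move=> H; have [/H//|/ltW x0] := leP 0 x.
  by have := H (- x); rewrite opprK sqrrN oppr_ge0 addrC; exact.
have [x2|x2] := leP x (2^-1).
  have e1 : expR x * (1 - x) <= 1.
    have := expR_ge1Dx (- x); rewrite expRN => h.
    have := ler_wpM2l (expR_ge0 x) h.
    by rewrite divff ?gt_eqF ?expR_gt0.
  have e2 : expR (- x) * (1 + x) <= 1.
    have h := expR_ge1Dx x; have := ler_wpM2l (expR_ge0 (- x)) h.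
    by rewrite expRN mulVf ?gt_eqF ?expR_gt0.
  have x2_gt0 : 0 < 1 - x ^+ 2 by nra.
  apply: (@le_trans _ _ (2 * (1 + 2 * x ^+ 2))).
    rewrite -(ler_pM2r x2_gt0); apply: (@le_trans _ _ 2); last first.
      have : 0 <= x ^+ 2 * (1 - 2 * x ^+ 2) by rewrite mulr_ge0 ?sqr_ge0 //; nra.
      by lra.
    have f1 : expR x * (1 - x) * (1 + x) <= 1 + x by rewrite ler_piMl //; lra.
    have f2 : expR (- x) * (1 + x) * (1 - x) <= 1 - x by rewrite ler_piMl //; lra.
    by lra.
  by rewrite ler_pM2l // expR_ge1Dx.
have h1 : expR x <= expR (2 * x ^+ 2) by rewrite ler_expR; nra.
have h2 : expR (- x) <= expR (2 * x ^+ 2) by rewrite ler_expR; nra.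
by lra.
Qed.

End Inequalities.

(** * Khintchine's inequality for random signs *)

Section RandomSigns.
Context {R : realType}.
Implicit Types (r : R).

Definition sign_sum n (e : {ffun 'I_n -> bool}) (a : 'I_n -> R) : R :=
  \sum_i (-1) ^+ e i * a i.

(** A constant for [r]-th moments, so norm estimates involve its [r]-th root. The power of [r] comes
    from [powR_le_expR], and [2 * expR 2] from the exponential moments of a sum and of its
    negative. *)
Definition khintchine_const r : R := r `^ r * (2 * expR 2).

Lemma khintchine_const_gt0 r : 0 < r -> 0 < khintchine_const r.
Proof. by move=> r0; rewrite !mulr_gt0 ?powR_gt0 ?expR_gt0. Qed.

Lemma sum_sign_expR n (a : 'I_n -> R) :
  \sum_e expR (sign_sum e a) = \prod_i (expR (a i) + expR (- a i)).
Proof.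
have -> : \sum_(e : {ffun 'I_n -> bool}) expR (sign_sum e a) =
    \sum_(e : {ffun 'I_n -> bool}) \prod_i expR ((-1) ^+ e i * a i).
  by apply: eq_bigr => e _; rewrite -expR_sum.
rewrite -(bigA_distr_bigA (fun i (b : bool) => expR ((-1) ^+ b * a i))).
by apply: eq_bigr => i _; rewrite big_bool /= addrC expr0 expr1 mul1r mulN1r.
Qed.

Lemma sum_sign_expR_le n (a : 'I_n -> R) : \sum_i a i ^+ 2 <= 1 ->
  \sum_e expR (sign_sum e a) <= 2 ^+ n * expR 2.
Proof.
move=> a1; rewrite sum_sign_expR.
apply: (@le_trans _ _ (\prod_(i < n) (2 * expR (2 * a i ^+ 2)))).
  by apply: ler_prod => i _; rewrite addr_ge0 ?expR_ge0 //= cosh_le.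
rewrite big_split /= prodr_const card_ord ler_wpM2l ?exprn_ge0 //.
by rewrite -expR_sum -mulr_sumr ler_expR -[leRHS]mulr1 ler_pM2l.
Qed.

(** Once [a] is scaled to Euclidean length 1, [powR_le_expR] bounds each summand by exponentials of
    the signed sum and of its negative, and [sum_sign_expR_le] applies to both. *)
Lemma khintchine n r (a : 'I_n -> R) : 0 < r ->
  \sum_e `|sign_sum e a| `^ r <=
  2 ^+ n * (khintchine_const r * (\sum_i a i ^+ 2) `^ (r / 2)).
Proof.
move=> r0; have V0 : 0 <= \sum_i a i ^+ 2 by apply: sumr_ge0 => i _; exact: sqr_ge0.
have rhs0 : 0 <= 2 ^+ n * (khintchine_const r * (\sum_i a i ^+ 2) `^ (r / 2)).
  by rewrite mulr_ge0 ?exprn_ge0 // mulr_ge0 ?powR_ge0 ?ltW ?khintchine_const_gt0.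
(* The scaling divides by the Euclidean length, so the zero vector is treated apart. *)
have [VE|VN] := eqVneq (\sum_i a i ^+ 2) 0.
  have a0 i : a i = 0.
    apply/eqP; rewrite -sqrf_eq0; apply/eqP.
    by move: VE => /psumr_eq0P; apply => // j _; exact: sqr_ge0.
  rewrite big1 // => e _; rewrite /sign_sum big1 ?normr0 ?powR0 ?gt_eqF //.
  by move=> i _; rewrite a0 mulr0.
set V := \sum_i a i ^+ 2 in V0 VN rhs0 *.
pose W := V `^ 2^-1.
have W0 : 0 < W by rewrite powR_gt0 // lt_neqAle eq_sym VN.
have W2 : W ^+ 2 = V by rewrite -powR_mulrn ?ltW // powRVK.
have b1 : \sum_i (a i / W) ^+ 2 <= 1.
  under eq_bigr do rewrite expr_div_n.
  by rewrite -mulr_suml W2 divff.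
have b1' : \sum_i (- (a i / W)) ^+ 2 <= 1 by under eq_bigr do rewrite sqrrN.
have sE (e : {ffun 'I_n -> bool}) : sign_sum e a = W * sign_sum e (fun i => a i / W).
  rewrite /sign_sum mulr_sumr; apply: eq_bigr => i _; field.
  by rewrite gt_eqF.
have sN (e : {ffun 'I_n -> bool}) :
    sign_sum e (fun i => - (a i / W)) = - sign_sum e (fun i => a i / W).
  by rewrite /sign_sum -sumrN; apply: eq_bigr => i _; rewrite mulrN.
under eq_bigr do rewrite sE normrM powRM // gtr0_norm //.
have -> : V `^ (r / 2) = W `^ r by rewrite mulrC powRrM.
rewrite -mulr_sumr [leRHS]mulrA [leRHS]mulrC; apply: ler_wpM2l; first exact: powR_ge0.
apply: (@le_trans _ _ (\sum_(e : {ffun 'I_n -> bool}) r `^ r *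
    (expR (sign_sum e (fun i => a i / W)) +
     expR (sign_sum e (fun i => - (a i / W)))))).
  apply: ler_sum => e _; apply: le_trans (powR_le_expR r0 _) _ => //.
  apply: ler_wpM2l; first exact: powR_ge0.
  rewrite sN; set s := sign_sum _ _.
  by have [s0|s0] := ger0P s; rewrite ?lerDl ?lerDr expR_ge0.
rewrite -mulr_sumr big_split /= /khintchine_const mulrCA.
apply: ler_wpM2l; first exact: powR_ge0.
rewrite [leRHS]mulrCA mulr2n mulrDl !mul1r.
by apply: lerD; apply: sum_sign_expR_le.
Qed.

End RandomSigns.

(** * The l_p norms and the gauges of their unit balls *)

Section LpNorm.
Context {R : realType} {m : nat}.
Implicit Types (p : \bar R) (x : 'rV[R]_m) (r : R).

Lemma lpnorm_ge0 p x : 0 <= lpnorm p x.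
Proof. by case: p => [r| |] //=; [exact: powR_ge0|exact: bigmax_ge_id]. Qed.

Lemma lpnorm1E x : lpnorm 1%:E x = \sum_i `|x ord0 i|.
Proof.
rewrite /lpnorm invr1 powRr1; first by apply: eq_bigr => i _; rewrite powRr1.
by apply: sumr_ge0 => i _; exact: powR_ge0.
Qed.

Lemma lpnorm_powR r x : 0 < r -> lpnorm r%:E x `^ r = \sum_i `|x ord0 i| `^ r.
Proof.
move=> r0; rewrite /= powRVK ?gt_eqF //.
by apply: sumr_ge0 => i _; exact: powR_ge0.
Qed.

Lemma lpnorm_le r x c : 0 < r -> 0 <= c ->
  \sum_i `|x ord0 i| `^ r <= c `^ r -> lpnorm r%:E x <= c.
Proof.
move=> r0 c0 h; rewrite -(powRK (lt0r_neq0 r0) c0) /=.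
by apply: ler_powR2 h; [rewrite invr_ge0 ltW|apply: sumr_ge0 => i _; exact: powR_ge0].
Qed.

Lemma lpnormZ p c x : (1%:E <= p)%E -> lpnorm p (c *: x) = `|c| * lpnorm p x.
Proof.
case: p => [r| |] //= p1.
  have r1 : 1 <= r by rewrite -lee_fin.
  have r0 : r != 0 by rewrite gt_eqF // (lt_le_trans ltr01).
  under eq_bigr do rewrite mxE normrM powRM //.
  rewrite -mulr_sumr powRM ?powR_ge0 ?powRK //.
  by apply: sumr_ge0 => i _; exact: powR_ge0.
under eq_bigr do rewrite mxE normrM.
rewrite (big_morph (fun y => `|c| * y) (id1 := 0) (op1 := Num.max)) ?mulr0 //.
by move=> y z; rewrite maxr_pMr.
Qed.

Lemma lpnorm0_eq0 p x : (1%:E <= p)%E -> lpnorm p x = 0 -> x = 0.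
Proof.
move=> p1 x0; apply/rowP => i; rewrite mxE; apply/normr0_eq0.
move: p p1 x0 => [r| |] //= p1 => [/powR_eq0_eq0|x0].
  move=> /psumr_eq0P h; apply: (@powR_eq0_eq0 _ _ r).
  by rewrite h // => j _; exact: powR_ge0.
apply/eqP; rewrite eq_le normr_ge0 andbT -x0.
exact: (le_bigmax _ (fun i => `|x ord0 i|)).
Qed.

Lemma lpnorm_gt0 p x : (1%:E <= p)%E -> x != 0 -> 0 < lpnorm p x.
Proof.
move=> p1; apply: contraNlt => h; apply/eqP; apply: (lpnorm0_eq0 p1).
by apply/eqP; rewrite eq_le h lpnorm_ge0.
Qed.

Lemma gauge_norm_lpball p (E : {vspace 'rV[R]_m}) (v : subvs_of E) :
  (1%:E <= p)%E -> gauge_norm (section_of (lpball p) (E := E)) v = lpnorm p (vsval v).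
Proof.
move=> p1; rewrite /gauge_norm; set S := mkset _.
have SE t : S t <-> 0 < t /\ lpnorm p (vsval v) <= t.
  split=> [[t0 [y yK ->]]|[t0 vt]].
    split=> //=; rewrite lpnormZ // gtr0_norm // ler_piMr ?(ltW t0) //.
  split=> //; exists (t^-1 *: v); last by rewrite scalerA divff ?scale1r ?gt_eqF.
  rewrite /section_of /lpball /= lpnormZ // gtr0_norm ?invr_gt0 //.
  by rewrite mulrC ler_pdivrMr // mul1r.
have lbS : lbound S (lpnorm p (vsval v)) by move=> t /SE[].
apply/eqP; rewrite eq_le; apply/andP; split.
  (* A margin [e] is added because the scaling factors must be positive: at [v = 0] the infimum is
     not attained. *)
  apply/ler_addgt0Pl => e e0; apply: ge_inf; first by exists (lpnorm p (vsval v)).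
  apply/SE; split; last by rewrite lerDr ltW.
  by rewrite ltr_pwDl // lpnorm_ge0.
apply: lb_le_inf lbS; exists (1 + lpnorm p (vsval v)); apply/SE; split.
  by rewrite ltr_pwDl // lpnorm_ge0.
by rewrite lerDr.
Qed.

End LpNorm.

#[local] Arguments lpnorm : simpl never.

(** * Reduction of [Gamma] to estimates for matrices *)

Section Gamma.
Context {R : realType} {n m : nat}.
Implicit Types (p q : \bar R) (X : 'M[R]_(n, m)).

Lemma opnorm_ge (U V : Type) (normU : U -> R) (normV : V -> R) (f : U -> V) u :
  normU u <= 1 -> ((normV (f u))%:E <= opnorm normU normV f)%E.
Proof. by move=> u1; apply: ereal_sup_ubound; exists u. Qed.

(** Given a factorization, [X] is the matrix of [A] divided by its norm, so its rows, images of unit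
    vectors, lie in the l_p ball. As [B] sends [A t] back to [t], the quotient of norms at [t]
    bounds the norm of [B] from below. *)
Lemma le_Gamma p q (a : R) : (1%:E <= p)%E -> (1%:E <= q)%E -> (0 < n)%N -> 0 <= a ->
  (forall X, (forall i, lpnorm p (row i X) <= 1) ->
    exists2 t : 'rV_n, t != 0 & a * lpnorm q (t *m X) <= lpnorm 1%:E t) ->
  (a%:E <= Gamma n (@lpball R m p) (@lpball R m q))%E.
Proof.
move=> p1 q1 n0 a0 H; apply: le_ereal_inf_tmp => _ [E [B [A [dE AB ->]]]].
set sA := opnorm _ _ A; set sB := opnorm _ _ B.
have ABK v : A (B v) = v by rewrite -comp_lfunE AB id_lfunE.
(* [B] is injective between spaces of dimension [n], hence onto, and its left inverse [A] is also a
   right inverse. *)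
have BAK t : B (A t) = t.
  have kB : lker B == 0%VS by apply/lker0P; exact: can_inj ABK.
  have : t \in limg B.
    suff -> : limg B = fullv by rewrite memvf.
    apply/eqP; rewrite eqEdim subvf /= limg_dim_eq; last by rewrite (eqP kB) capv0.
    rewrite !dimvf.
    by have -> : dim (subvs_of E) = \dim E by []; rewrite dE /dim /= mul1n.
  by move=> /memv_imgP[v _ ->]; rewrite ABK.
have A_neq0 t : t != 0 -> vsval (A t) != 0.
  apply: contra => /eqP At0; rewrite -[t]BAK.
  have -> : A t = 0 by apply: val_inj.
  by rewrite linear0.
have sB_ge t : t != 0 -> ((lpnorm 1%:E t / lpnorm q (vsval (A t)))%:E <= sB)%E.
  move=> t0; have At0 := lpnorm_gt0 q1 (A_neq0 _ t0).
  pose u := (lpnorm q (vsval (A t)))^-1 *: A t.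
  have u1 : gauge_norm (section_of (lpball q) (E := E)) u <= 1.
    rewrite gauge_norm_lpball // linearZ /= lpnormZ // gtr0_norm ?invr_gt0 //.
    by rewrite mulVf ?gt_eqF.
  have := opnorm_ge (@lpnorm R n 1%:E) B u1.
  by rewrite /u linearZ /= BAK lpnormZ // gtr0_norm ?invr_gt0 // mulrC.
have e_neq0 (i : 'I_n) : delta_mx ord0 i != 0 :> 'rV[R]_n.
  by apply/eqP => /rowP/(_ i); rewrite !mxE !eqxx => /eqP; rewrite oner_eq0.
have e1 (i : 'I_n) : lpnorm 1%:E (delta_mx ord0 i : 'rV[R]_n) = 1.
  rewrite lpnorm1E (bigD1 i) //= mxE !eqxx normr1 big1 ?addr0 // => j ji.
  by rewrite mxE (negPf ji) andbF normr0.
have sA_ge i : ((lpnorm p (vsval (A (delta_mx ord0 i))))%:E <= sA)%E.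
  by rewrite -gauge_norm_lpball //; apply: opnorm_ge; rewrite e1.
pose i0 := Ordinal n0.
have sA0 : (0 < sA)%E.
  by apply: lt_le_trans (sA_ge i0); rewrite lte_fin lpnorm_gt0 // A_neq0.
have sB0 : (0 < sB)%E.
  apply: lt_le_trans (sB_ge _ (e_neq0 i0)).
  by rewrite lte_fin divr_gt0 // lpnorm_gt0 // A_neq0.
(* If the norm of [A] is infinite, so is its product with the positive norm of [B]. *)
move: sA0 sA_ge; case: sA => [r| |] // r0 r_ge; last first.
  by rewrite gt0_mulye // leey.
rewrite lte_fin in r0.
pose X := r^-1 *: lin1_mx (linfun vsval \o A)%VF.
have XE t : t *m X = r^-1 *: vsval (A t).
  by rewrite -scalemxAr mul_rV_lin1 /= comp_lfunE lfunE.
have [i|t t0 tX] := H X.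
  rewrite rowE XE lpnormZ // gtr0_norm ?invr_gt0 // mulrC ler_pdivrMr // mul1r.
  by have := r_ge i; rewrite lee_fin.
apply: (@le_trans _ _ (r%:E * (lpnorm 1%:E t / lpnorm q (vsval (A t)))%:E)%E).
  have At0 := lpnorm_gt0 q1 (A_neq0 _ t0).
  rewrite -EFinM lee_fin mulrA ler_pdivlMr // mulrC -ler_pdivrMl //.
  by move: tX; rewrite XE lpnormZ // gtr0_norm ?invr_gt0 // mulrCA [a * _]mulrC.
by apply: lee_pmul => //; rewrite ?lee_fin ?(ltW r0) ?divr_ge0 ?lpnorm_ge0 ?sB_ge.
Qed.

(** [E] is the row space of [X], [A] is multiplication by [X], and [B] is its inverse; the second
    inequality makes [A] injective. *)
Lemma Gamma_le p q X (D : R) : (1%:E <= p)%E -> (1%:E <= q)%E -> 0 <= D ->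
  (forall t, lpnorm p (t *m X) <= lpnorm 1%:E t) ->
  (forall t, lpnorm 1%:E t <= D * lpnorm q (t *m X)) ->
  (Gamma n (@lpball R m p) (@lpball R m q) <= D%:E)%E.
Proof.
move=> p1 q1 D0 Xp Xq.
have [f fE] : exists f : 'Hom('rV[R]_n, 'rV[R]_m), forall t, f t = t *m X.
  by exists (linfun (mulmxr X)) => t; rewrite lfunE.
have kf : lker f == 0%VS.
  apply/lker0P => s t; rewrite !fE => st; apply/eqP; rewrite -subr_eq0; apply/eqP.
  apply: (@lpnorm0_eq0 _ _ 1%:E) => //.
  apply/eqP; rewrite eq_le lpnorm_ge0 andbT; apply: le_trans (Xq _) _.
  rewrite mulmxBl st subrr -(scale0r (0 : 'rV_m)) lpnormZ //.
  by rewrite normr0 mul0r mulr0.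
have le0_opnorm (U V : vectType R) (nU : U -> R) (nV : V -> R) (g : U -> V) :
    nU 0 <= 1 -> 0 <= nV (g 0) -> (0 <= opnorm nU nV g)%E.
  by move=> u0 v0; apply: le_trans (opnorm_ge nV g u0); rewrite lee_fin.
have norm0 k p' : (1%:E <= p')%E -> lpnorm p' (0 : 'rV[R]_k) = 0.
  by move=> p'1; rewrite -(scale0r (0 : 'rV_k)) lpnormZ // normr0 mul0r.
apply: le_trans (_ : (opnorm (@lpnorm R n 1%:E)
    (gauge_norm (section_of (lpball p) (E := limg f))) (linfun (vsproj (limg f)) \o f)%VF *
  opnorm (gauge_norm (section_of (lpball q) (E := limg f))) (@lpnorm R n 1%:E)
    (f^-1 \o linfun vsval)%VF <= _)%E).
  apply: ereal_inf_lbound.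
  exists (limg f), (f^-1 \o linfun vsval)%VF, (linfun (vsproj (limg f)) \o f)%VF; split=> //.
    by rewrite limg_dim_eq ?(eqP kf) ?capv0 // dimvf /dim /= mul1n.
  apply/lfunP => v; rewrite !comp_lfunE !lfunE /= limg_lfunVK ?vsvalK //.
  exact: subvsP.
rewrite -[D%:E]mul1e; apply: lee_pmul.
- apply: le0_opnorm; rewrite ?norm0 // gauge_norm_lpball //; exact: lpnorm_ge0.
- by apply: le0_opnorm; rewrite ?gauge_norm_lpball ?linear0 ?norm0 //; exact: lpnorm_ge0.
- apply: ge_ereal_sup => _ [t /= t1 <-]; rewrite lee_fin gauge_norm_lpball //.
  rewrite comp_lfunE lfunE /= vsprojK ?memv_img ?memvf // fE.
  exact: le_trans (Xp _) _.
- apply: ge_ereal_sup => _ [v /= v1 <-]; rewrite lee_fin.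
  rewrite comp_lfunE lfunE /=; apply: le_trans (Xq _) _.
  rewrite -fE limg_lfunVK; last exact: subvsP.
  by rewrite -[leRHS]mulr1 ler_wpM2l // -gauge_norm_lpball.
Qed.

End Gamma.

(** * Comparison of l_p norms with different exponents *)

Section LpNormComparison.
Context {R : realType} {m : nat}.
Implicit Types (p q : \bar R) (x : 'rV[R]_m) (r s : R).

Lemma norm_le_lpnorm p x i : (1%:E <= p)%E -> `|x ord0 i| <= lpnorm p x.
Proof.
case: p => [r| |] //= p1; last exact: (le_bigmax _ (fun i => `|x ord0 i|)).
have r0 : 0 < r by rewrite (lt_le_trans ltr01) // -lee_fin.
rewrite /lpnorm -[leLHS](powRK (lt0r_neq0 r0)) //.
apply: ler_powR2; [by rewrite invr_ge0 ltW|exact: powR_ge0|].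
by rewrite (bigD1 i) //= lerDl; apply: sumr_ge0 => j _; exact: powR_ge0.
Qed.

Lemma lpnormy_le x c : 0 <= c -> (forall i, `|x ord0 i| <= c) -> lpnorm +oo%E x <= c.
Proof. by move=> c0 xc; apply: bigmax_le. Qed.

Lemma invexpE r : 1 <= r -> invexp r%:E = r^-1.
Proof. by move=> r1; rewrite /invexp fine_invr. Qed.

Lemma invexpy : invexp (+oo%E : \bar R) = 0.
Proof. by rewrite /invexp invey. Qed.

(** For finite exponents, superadditivity of the power [p / q >= 1] is applied to the [q]-th powers
    of the entries. *)
Lemma lpnorm_anti p q x : (1%:E <= q)%E -> (q <= p)%E -> lpnorm p x <= lpnorm q x.
Proof.
case: p q => [p| |] [q| |] q1 qp;
  [|by []|by []| |exact: lexx|by []|by []|by []|by []].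
- have {}q1 : 1 <= q by rewrite -lee_fin.
  have {}qp : q <= p by rewrite -lee_fin.
  have q0 : 0 < q by exact: lt_le_trans q1.
  have p0 : 0 < p by exact: lt_le_trans qp.
  apply: lpnorm_le => //; first exact: lpnorm_ge0.
  have -> : p = q * (p / q) by field; rewrite gt_eqF.
  rewrite powRrM lpnorm_powR //.
  under eq_bigr do rewrite powRrM.
  by apply: sum_powR_le => [|i]; [rewrite ler_pdivlMr // mul1r|exact: powR_ge0].
- by apply: lpnormy_le => [|i]; [exact: lpnorm_ge0|exact: norm_le_lpnorm].
Qed.

(** For finite exponents this is the power mean inequality with exponent [p / q], applied to the
    [q]-th powers of the entries. *)
Lemma lpnorm_le_dim p q x : (1%:E <= q)%E -> (q <= p)%E ->
  lpnorm q x <= m%:R `^ (invexp q - invexp p) * lpnorm p x.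
Proof.
case: p q => [p| |] [q| |] q1 qp;
  [|by []|by []| | |by []|by []|by []|by []].
- have {}q1 : 1 <= q by rewrite -lee_fin.
  have {}qp : q <= p by rewrite -lee_fin.
  have q0 : 0 < q by exact: lt_le_trans q1.
  have p0 : 0 < p by exact: lt_le_trans qp.
  rewrite !invexpE ?(le_trans q1) //.
  have [L L0 [-> Lp]] : exists2 L, 0 <= L &
      lpnorm p%:E x = L /\ L `^ p = \sum_i `|x ord0 i| `^ p.
    by exists (lpnorm p%:E x); [exact: lpnorm_ge0|split; rewrite ?lpnorm_powR].
  apply: lpnorm_le => //; first by rewrite mulr_ge0 ?powR_ge0.
  have pq1 : 1 <= p / q by rewrite ler_pdivlMr // mul1r.
  have pq0 : 0 < p / q by rewrite divr_gt0.
  rewrite powRM ?powR_ge0 // -powRrM.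
  have S0 : 0 <= \sum_i `|x ord0 i| `^ q by apply: sumr_ge0 => i _; exact: powR_ge0.
  rewrite -[leLHS](powRK (lt0r_neq0 pq0)) //.
  have pqE : p * (p / q)^-1 = q by field; rewrite !gt_eqF.
  rewrite -[in L `^ q]pqE [L `^ _]powRrM.
  have -> : (q^-1 - p^-1) * q = (p / q - 1) * (p / q)^-1.
    by field; rewrite !gt_eqF.
  rewrite [m%:R `^ _]powRrM -powRM ?powR_ge0 //.
  apply: ler_powR2; [by rewrite invr_ge0 ltW|exact: powR_ge0|].
  rewrite Lp; apply: le_trans (powR_mean pq1 _) _ => [i|].
    exact: powR_ge0.
  apply: ler_wpM2l; first exact: powR_ge0.
  apply: ler_sum => i _; rewrite -powRrM.
  by have -> : q * (p / q) = p by field; rewrite gt_eqF.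
- have {}q1 : 1 <= q by rewrite -lee_fin.
  have q0 : 0 < q by exact: lt_le_trans q1.
  rewrite invexpE // invexpy subr0; apply: lpnorm_le => //.
    by rewrite mulr_ge0 ?powR_ge0 ?lpnorm_ge0.
  rewrite powRM ?powR_ge0 ?lpnorm_ge0 // powRVK ?gt_eqF ?ler0n //.
  apply: (@le_trans _ _ (\sum_(i < m) lpnorm +oo%E x `^ q)).
    apply: ler_sum => i _; apply: ler_powR2; rewrite ?(ltW q0) //.
    by apply: norm_le_lpnorm; rewrite leey.
  by rewrite sumr_const card_ord mulr_natl.
- by rewrite subrr powRr0 mul1r lexx.
Qed.

End LpNormComparison.

(** * Upper bounds from unit vectors, blocks and cosines *)

Section UpperBounds.
Context {R : realType}.
Implicit Types (p q : \bar R) (n m k : nat).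

Lemma lpnorm_row_mx0 p n k (x : 'rV[R]_n) : (1%:E <= p)%E ->
  lpnorm p (row_mx x (0 : 'rV_k)) = lpnorm p x.
Proof.
case: p => [r| |] //= p1; last first.
  apply/eqP; rewrite eq_le; apply/andP; split; apply: lpnormy_le.
  - exact: lpnorm_ge0.
  - move=> i; case: (split_ordP i) => j ->; first by rewrite row_mxEl norm_le_lpnorm.
    by rewrite row_mxEr mxE normr0 lpnorm_ge0.
  - exact: lpnorm_ge0.
  - by move=> i; rewrite -(row_mxEl x (0 : 'rV_k)) norm_le_lpnorm.
rewrite /lpnorm big_split_ord /=.
under eq_bigr do rewrite row_mxEl.
rewrite [X in _ + X]big1 ?addr0 // => i _.
by rewrite row_mxEr mxE normr0 powR0 // gt_eqF // (lt_le_trans ltr01).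
Qed.

(** Appending zero columns changes no norm, so the vectors may be built in any dimension [N] up to
    [m]. *)
Lemma Gamma_le_embed n N m p q (X : 'M[R]_(n, N)) D :
  (N <= m)%N -> (1%:E <= p)%E -> (1%:E <= q)%E -> 0 <= D ->
  (forall t, lpnorm p (t *m X) <= lpnorm 1%:E t) ->
  (forall t, lpnorm 1%:E t <= D * lpnorm q (t *m X)) ->
  (Gamma n (@lpball R m p) (@lpball R m q) <= D%:E)%E.
Proof.
move=> /subnKC <- p1 q1 D0 Xp Xq.
by apply: (@Gamma_le _ _ _ _ _ (row_mx X 0)) => // t;
   rewrite mul_mx_row mulmx0 lpnorm_row_mx0.
Qed.

Lemma Gamma_le_identity n m p q : (n <= m)%N -> (1%:E <= p)%E -> (1%:E <= q)%E ->
  (Gamma n (@lpball R m p) (@lpball R m q) <= (n%:R `^ (1 - invexp q))%:E)%E.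
Proof.
move=> nm p1 q1; apply: (@Gamma_le_embed _ _ _ _ _ 1%:M) => // t.
- by rewrite mulmx1; exact: lpnorm_anti.
- rewrite mulmx1; apply: le_trans (lpnorm_le_dim _ _ q1) _ => //.
  by rewrite invexpE // invr1.
Qed.

(* Row [i] takes the value [c] on the [i]-th of [n] consecutive blocks of length
   [k], and 0 elsewhere. *)
Definition flat_block_mx n k (c : R) : 'M[R]_(n, n * k) :=
  \matrix_(i < n) mxvec (\matrix_(i' < n, j < k) (c *+ (i' == i))).

Lemma mul_flat_block_mx n k c (t : 'rV[R]_n) i (j : 'I_k) :
  (t *m flat_block_mx n k c) ord0 (mxvec_index i j) = c * t ord0 i.
Proof.
rewrite mxE (bigD1 i) //= big1 => [|i' ni]; last first.
  by rewrite mxE mxvecE mxE eq_sym (negPf ni) mulr0.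
by rewrite mxE mxvecE mxE eqxx addr0 mulrC.
Qed.

Lemma lpnorm_flat_block n k c (r : R) (t : 'rV[R]_n) : 1 <= r -> 0 <= c ->
  lpnorm r%:E (t *m flat_block_mx n k c) = c * k%:R `^ r^-1 * lpnorm r%:E t.
Proof.
move=> r1 c0; have r0 : r != 0 by rewrite gt_eqF // (lt_le_trans ltr01).
rewrite /lpnorm (reindex _ (curry_mxvec_bij n k)) /=.
rewrite (eq_bigr (fun ij : 'I_n * 'I_k =>
  `|(t *m flat_block_mx n k c) ord0 (mxvec_index ij.1 ij.2)| `^ r)); last by case.
rewrite -(pair_bigA _ (fun i j => `|(t *m flat_block_mx n k c) ord0 (mxvec_index i j)| `^ r)).
rewrite (eq_bigr (fun i => c `^ r * k%:R * `|t ord0 i| `^ r)) => [|i _].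
  rewrite -mulr_sumr powRM ?mulr_ge0 ?powR_ge0 //; last first.
    by apply: sumr_ge0 => i _; exact: powR_ge0.
  by rewrite powRM ?powR_ge0 // powRK.
under eq_bigr do rewrite mul_flat_block_mx normrM powRM // (ger0_norm c0).
by rewrite sumr_const card_ord -[LHS]mulr_natl mulrCA mulrA.
Qed.

Lemma Gamma_le_block n k m (p q : R) : (0 < k)%N -> (n * k <= m)%N ->
  1 <= p -> 1 <= q ->
  (Gamma n (@lpball R m p%:E) (@lpball R m q%:E) <=
    (n%:R `^ (1 - q^-1) * k%:R `^ (p^-1 - q^-1))%:E)%E.
Proof.
move=> k0 nkm p1 q1; have kR : 0 < k%:R :> R by rewrite ltr0n.
(* The height [k^(-1/p)] makes multiplication by the matrix an isometry for l_p; l_q norms are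
   multiplied by [k^(1/q - 1/p)]. *)
apply: (@Gamma_le_embed _ _ _ _ _ (flat_block_mx n k (k%:R `^ (- p^-1)))) => // t.
- rewrite lpnorm_flat_block ?powR_ge0 // -powRD ?(gt_eqF kR) ?implybT //.
  by rewrite addNr powRr0 mul1r; exact: lpnorm_anti.
- rewrite lpnorm_flat_block ?powR_ge0 // -powRD ?(gt_eqF kR) ?implybT //.
  rewrite -mulrA [X in _ * X]mulrA -powRD ?(gt_eqF kR) ?implybT //.
  have -> : p^-1 - q^-1 + (- p^-1 + q^-1) = 0 by ring.
  rewrite powRr0 mul1r; apply: le_trans (lpnorm_le_dim (p := q%:E) _ _ _) _ => //.
  by rewrite !invexpE // invr1.
Qed.

Lemma sin_natpi k : sin (k%:R * pi) = 0 :> R.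
Proof.
elim: k => [|k IH]; first by rewrite mul0r sin0.
by rewrite -natr1 mulrDl mul1r sinDpi IH oppr0.
Qed.

(** Telescoping: each term on the left is [sin ((2j + 2) a) - sin (2j a)]. *)
Lemma sum_cos_odd N (a : R) :
  2 * sin a * (\sum_(j < N) cos (j.*2.+1%:R * a)) = sin (N.*2%:R * a).
Proof.
elim: N => [|N IH]; first by rewrite big_ord0 mulr0 mul0r sin0.
rewrite big_ord_recr /= mulrDr IH doubleS.
have -> : N.*2%:R * a = N.*2.+1%:R * a - a by rewrite -natr1; ring.
have -> : N.*2.+2%:R * a = N.*2.+1%:R * a + a by rewrite -[N.*2.+2%:R]natr1; ring.
by rewrite sinB sinD; ring.
Qed.

(** At this angle [a] the right side of [sum_cos_odd] is [sin (k pi) = 0], whereas [0 < a < pi]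
    keeps [sin a] nonzero. *)
Lemma sum_cos_odd0 N k : (0 < k < N.*2)%N ->
  \sum_(j < N) cos (j.*2.+1%:R * (k%:R / N.*2%:R * pi)) = 0 :> R.
Proof.
move=> /andP[k0 kN]; set a := k%:R / N.*2%:R * pi.
have N0 : 0 < N.*2%:R :> R by rewrite ltr0n (leq_ltn_trans _ kN).
have kR : 0 < k%:R :> R by rewrite ltr0n.
have sa : 0 < sin a.
  apply: sin_gt0_pi; rewrite /a mulr_gt0 ?pi_gt0 ?divr_gt0 //=.
  by rewrite gtr_pMl ?pi_gt0 // ltr_pdivrMr // mul1r ltr_nat.
have := sum_cos_odd N a.
have -> : N.*2%:R * a = k%:R * pi by rewrite /a; field; rewrite gt_eqF.
by rewrite sin_natpi => /eqP; rewrite mulf_eq0 (gt_eqF (mulr_gt0 _ sa)) // => /eqP.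
Qed.

(** The first [n] rows of the unnormalized cosine transform of type II. Row 0 is constant and has
    twice the squared length of the others when [n <= N]. *)
Definition dct n N : 'M[R]_(n, N) :=
  \matrix_(i, j) cos (j.*2.+1%:R * (i%:R / N.*2%:R * pi)).

(** The product-to-sum formula produces the frequencies [i - i'] and [i + i']; for [i' < i] both lie
    strictly between 0 and [2N]. *)
Lemma dct_gram n N (i i' : 'I_n) : (n <= N)%N -> i != i' ->
  \sum_j dct n N i j * dct n N i' j = 0.
Proof.
move=> nN; wlog ii' : i i' / (i' < i)%N => [H ne|_].
  have [lt|lt|/val_inj e] := ltngtP i' i; first exact: H.
    by under eq_bigr do rewrite mulrC; apply: H; rewrite // eq_sym.
  by rewrite e eqxx in ne.
have N0 : (0 < N)%N by rewrite (leq_trans _ nN) // (leq_ltn_trans _ (ltn_ord i)).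
have NR : N.*2%:R != 0 :> R by rewrite pnatr_eq0 double_eq0 -lt0n.
apply: (mulfI (_ : 2 != 0 :> R)) => //; rewrite mulr0 mulr_sumr.
rewrite (eq_bigr (fun j : 'I_N => cos (j.*2.+1%:R * ((i - i')%N%:R / N.*2%:R * pi)) +
    cos (j.*2.+1%:R * ((i + i')%N%:R / N.*2%:R * pi)))) => [|j _].
  rewrite big_split /= !sum_cos_odd0 ?addr0 //.
    by have := ltn_ord i; lia.
  by have := ltn_ord i; lia.
rewrite !mxE natrB ?(ltnW ii') // natrD !mulrBl !mulrDl mulrBr mulrDr cosB cosD.
by ring.
Qed.

(** By the double-angle formula the cosines of doubled frequency sum to 0, except for row 0, where
    they only increase the total. *)
Lemma dct_gram_diag n N (i : 'I_n) : (n <= N)%N ->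
  N%:R / 2 <= \sum_j dct n N i j ^+ 2.
Proof.
move=> nN; have N0 : (0 < N)%N by rewrite (leq_trans _ nN) // (leq_ltn_trans _ (ltn_ord i)).
have -> : \sum_j dct n N i j ^+ 2 =
    \sum_(j < N) (2^-1 + 2^-1 * cos (j.*2.+1%:R * (i.*2%:R / N.*2%:R * pi))).
  apply: eq_bigr => j _; rewrite mxE.
  have -> : j.*2.+1%:R * (i.*2%:R / N.*2%:R * pi) =
      (j.*2.+1%:R * (i%:R / N.*2%:R * pi)) *+ 2 :> R.
    by rewrite -[i.*2]muln2 natrM -[RHS]mulr_natr; ring.
  by rewrite cos_mulr2n -mulr_natr; field.
rewrite big_split /= sumr_const card_ord -[2^-1 *+ N]mulr_natl lerDl -mulr_sumr mulr_ge0 //.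
have [i0|i0] := posnP i.
  by rewrite i0; apply: sumr_ge0 => j _; rewrite !mul0r mulr0 cos0.
by rewrite sum_cos_odd0 // double_gt0 i0 ltn_double (leq_trans _ nN).
Qed.

Lemma dct_l2 n N (t : 'rV[R]_n) : (n <= N)%N ->
  N%:R / 2 * (\sum_i t ord0 i ^+ 2) <= \sum_j (t *m dct n N) ord0 j ^+ 2.
Proof.
move=> nN.
have -> : \sum_j (t *m dct n N) ord0 j ^+ 2 =
    \sum_i t ord0 i ^+ 2 * \sum_j dct n N i j ^+ 2.
  under eq_bigr do rewrite mxE expr2 big_distrlr /=.
  rewrite exchange_big /=; apply: eq_bigr => i _.
  rewrite exchange_big /= (bigD1 i) //= [X in _ + X]big1 => [|i' ne].
    by rewrite addr0 mulr_sumr; apply: eq_bigr => j _; ring.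
  rewrite (eq_bigr (fun j => t ord0 i * t ord0 i' * (dct n N i j * dct n N i' j))).
    by rewrite -mulr_sumr dct_gram ?mulr0 // eq_sym.
  by move=> j _; ring.
rewrite mulr_sumr; apply: ler_sum => i _; rewrite mulrC.
by apply: ler_wpM2l; [exact: sqr_ge0|exact: dct_gram_diag].
Qed.

(** Entries bounded by 1 allow the scaling [N^(-1/p)]. Then the l_1 norm of [t] is compared with l_2
    in dimension [n], [dct_l2] passes to the image, and [q >= 2] permits comparing l_2 with l_q in
    dimension [N]. The choice of [N] is left open: both [m] and [n] will serve. *)
Lemma Gamma_le_dct n N m (p : R) q : (0 < n)%N -> (n <= N <= m)%N -> 1 <= p ->
  (2%:E <= q)%E ->
  (Gamma n (@lpball R m p%:E) (@lpball R m q) <=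
    (2 * (n%:R `^ 2^-1 * N%:R `^ (p^-1 - invexp q)))%:E)%E.
Proof.
move=> n0 /andP[nN Nm] p1 q2.
have NR : 0 < N%:R :> R by rewrite ltr0n (leq_trans n0).
have p0 : 0 < p by exact: lt_le_trans p1.
have q1 : (1%:E <= q)%E by apply: le_trans q2; rewrite lee_fin ler1n.
have l2 k (x : 'rV[R]_k) : lpnorm 2%:E x ^+ 2 = \sum_i x ord0 i ^+ 2.
  rewrite -powR_mulrn ?lpnorm_ge0 // lpnorm_powR //.
  by apply: eq_bigr => i _; rewrite powR_mulrn // real_normK // num_real.
have [c c0 cE] : exists2 c, 0 < c & N%:R `^ (- p^-1) = c :> R.
  by exists (N%:R `^ (- p^-1)) => //; exact: powR_gt0.
apply: (@Gamma_le_embed _ _ _ _ _ (c *: dct n N)) => // t.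
- apply: lpnorm_le => //; first exact: lpnorm_ge0.
  apply: (@le_trans _ _ (\sum_(j < N) (c * lpnorm 1%:E t) `^ p)).
    apply: ler_sum => j _; apply: ler_powR2; rewrite ?(ltW p0) //.
    rewrite -scalemxAr mxE normrM gtr0_norm // ler_pM2l // mxE lpnorm1E.
    apply: le_trans (ler_norm_sum _ _ _) _; apply: ler_sum => i _.
    by rewrite mxE normrM ler_piMr // ler_norml cos_geN1 cos_le1.
  rewrite sumr_const card_ord -mulr_natl powRM ?lpnorm_ge0 ?(ltW c0) // mulrA.
  rewrite -cE -powRrM mulNr mulVf ?gt_eqF // powRN powRr1 ?ler0n //.
  by rewrite mulfV ?mul1r // gt_eqF.
- apply: le_trans (lpnorm_le_dim (p := 2%:E) _ _ _) _; rewrite ?lee_fin ?ler1n //.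
  rewrite !invexpE ?ler1n // invr1.
  have -> : 1 - 2^-1 = 2^-1 :> R by field.
  have Nc : N%:R `^ (p^-1 - invexp q) * c = N%:R `^ (- invexp q).
    by rewrite -cE -powRD ?(gt_eqF NR) ?implybT //; congr (_ `^ _); ring.
  rewrite -scalemxAr lpnormZ // (gtr0_norm c0).
  have -> : 2 * (n%:R `^ 2^-1 * N%:R `^ (p^-1 - invexp q)) * (c * lpnorm q (t *m dct n N)) =
      n%:R `^ 2^-1 * (2 * (N%:R `^ (p^-1 - invexp q) * c * lpnorm q (t *m dct n N))) by ring.
  rewrite Nc; apply: ler_wpM2l; first exact: powR_ge0.
  (* The factor 2 replaces the square root of 2 that [dct_l2] yields. *)
  apply: (@le_trans _ _ (2 * (N%:R `^ (- 2^-1) * lpnorm 2%:E (t *m dct n N)))).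
    rewrite -(@ler_pXn2r _ 2) ?nnegrE ?mulr_ge0 ?powR_ge0 ?lpnorm_ge0 //.
    rewrite !exprMn -(powR_mulrn 2 (powR_ge0 N%:R (- 2^-1))) -powRrM mulNr mulVf //.
    rewrite powRN powRr1 ?ler0n // !l2.
    have := ler_wpM2l (ltW (divr_gt0 (ltr0Sn _ 1) NR)) (dct_l2 t nN).
    have -> : 2 / N%:R * (N%:R / 2 * (\sum_i t ord0 i ^+ 2)) = \sum_i t ord0 i ^+ 2.
      by field; rewrite gt_eqF.
    move=> h; apply: le_trans h _; rewrite mulrA ler_wpM2r //.
      by apply: sumr_ge0 => j _; exact: sqr_ge0.
    by rewrite ler_wpM2r ?invr_ge0 ?ler0n // expr2; lra.
  rewrite ler_pM2l //.
  have := lpnorm_le_dim (t *m dct n N) (_ : (1%:E <= 2%:E)%E) q2.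
  rewrite lee_fin ler1n => /(_ isT); rewrite invexpE ?ler1n // => h.
  apply: le_trans (ler_wpM2l (powR_ge0 _ _) h) _.
  rewrite mulrA -powRD ?(gt_eqF NR) ?implybT //.
  by have -> : - 2^-1 + (2^-1 - invexp q) = - invexp q by ring.
Qed.

End UpperBounds.

(** * Averaging the l_r norm over sign vectors *)

Section SignLowerBound.
Context {R : realType}.
Implicit Types (r : R) (n m : nat).

(** The maximum unites two regimes: the power mean inequality for [r >= 2] and subadditivity of the
    power [r / 2] below. *)
Lemma sum_sqr_powR_le n r (a : 'I_n -> R) : 0 < r ->
  (\sum_i a i ^+ 2) `^ (r / 2) <=
  n%:R `^ (Num.max 1 (r / 2) - 1) * \sum_i `|a i| `^ r.
Proof.
move=> r0.
have aE i : (a i ^+ 2) `^ (r / 2) = `|a i| `^ r.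
  rewrite -real_normK ?num_real // -powR_mulrn // -powRrM.
  by have -> : 2 * (r / 2) = r by field.
have [r2|r2] := leP 1 (r / 2).
  apply: le_trans (powR_mean r2 _) _ => [i|]; first exact: sqr_ge0.
  by under eq_bigr do rewrite aE.
rewrite subrr powRr0 mul1r.
apply: le_trans (powR_sum_le _ _) _ => [|i|]; last by under eq_bigr do rewrite aE.
  by rewrite divr_gt0 //= ltW.
exact: sqr_ge0.
Qed.

(** Khintchine's inequality in every column; exchanging the sums then gives [n] row norms, each at
    most 1, which raise the exponent of [n] by one. *)
Lemma sum_sign_powR_le n m r (X : 'M[R]_(n, m)) : 0 < r ->
  (forall i, lpnorm r%:E (row i X) <= 1) ->
  \sum_e \sum_j `|sign_sum e (fun i => X i j)| `^ r <=
  2 ^+ n * (khintchine_const r * n%:R `^ Num.max 1 (r / 2)).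
Proof.
move=> r0 X1; rewrite exchange_big /=.
apply: le_trans.
  by apply: ler_sum => j _; exact: (khintchine (fun i => X i j) r0).
rewrite -mulr_sumr ler_wpM2l ?exprn_ge0 // -mulr_sumr.
apply: ler_wpM2l; first exact: ltW (khintchine_const_gt0 r0).
apply: le_trans.
  by apply: ler_sum => j _; exact: (sum_sqr_powR_le (fun i => X i j) r0).
rewrite -mulr_sumr exchange_big /=.
have [n0|n0] := posnP n.
  rewrite big1 ?mulr0 ?powR_ge0 // => i _; exfalso.
  by have := leq_ltn_trans (leq0n i) (ltn_ord i); rewrite n0.
rewrite powRB ?(gt_eqF (_ : 0 < n%:R)) ?ltr0n ?implybT // powRr1 ?ler0n //.
rewrite mulrAC ler_pdivrMr ?ltr0n // ler_wpM2l ?powR_ge0 //.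
have -> : n%:R = \sum_(i < n) 1 :> R by rewrite sumr_const card_ord.
apply: ler_sum => i _.
have := ler_powR2 (ltW r0) (lpnorm_ge0 _ _) (X1 i).
rewrite powR1 lpnorm_powR // (eq_bigr (fun j => `|X i j| `^ r)) // => j _.
by rewrite mxE.
Qed.

Definition sign_row n (e : {ffun 'I_n -> bool}) : 'rV[R]_n := \row_i (-1) ^+ e i.

Lemma mul_sign_row n m e (X : 'M[R]_(n, m)) j :
  (sign_row e *m X) ord0 j = sign_sum e (fun i => X i j).
Proof. by rewrite mxE; apply: eq_bigr => i _; rewrite mxE. Qed.

Lemma lpnorm1_sign_row n e : lpnorm 1%:E (@sign_row n e) = n%:R.
Proof.
rewrite lpnorm1E (eq_bigr (fun=> 1)) ?sumr_const ?card_ord // => i _.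
by rewrite mxE normrX normrN1 expr1n.
Qed.

(** Some sign vector does not exceed the average. *)
Lemma exists_sign_row n m r (X : 'M[R]_(n, m)) : 0 < r ->
  (forall i, lpnorm r%:E (row i X) <= 1) ->
  exists e, lpnorm r%:E (@sign_row n e *m X) <=
    (khintchine_const r * n%:R `^ Num.max 1 (r / 2)) `^ r^-1.
Proof.
move=> r0 X1; set P := khintchine_const r * _.
have P0 : 0 <= P by rewrite mulr_ge0 ?powR_ge0 ?ltW ?khintchine_const_gt0.
have [e eP] : exists e : {ffun 'I_n -> bool},
    \sum_j `|sign_sum e (fun i => X i j)| `^ r <= P.
  apply/existsP; apply: contraT; rewrite negb_exists => /forallP H.
  have := sum_sign_powR_le r0 X1; rewrite leNgt -/P => /negP[].
  have -> : 2 ^+ n * P = \sum_(e : {ffun 'I_n -> bool}) P.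
    by rewrite sumr_const card_ffun card_bool card_ord -natrX mulr_natl.
  apply: ltr_sum; last by move=> e _; rewrite ltNge H.
  by apply/hasP; exists [ffun=> true]; rewrite ?mem_index_enum.
exists e; rewrite -[leLHS](powRK (lt0r_neq0 r0)) ?lpnorm_ge0 //.
apply: ler_powR2; [by rewrite invr_ge0 ltW|exact: powR_ge0|].
by rewrite lpnorm_powR //; under eq_bigr do rewrite mul_sign_row.
Qed.

End SignLowerBound.

(** * Counting by code lengths, and Hamming balls *)

Section EntropyMethod.
Context {R : realType}.

(* [c i t] is a code length: Kraft's inequality for the product code bounds
   the number of values of [f] on [G]. *)
Lemma card_le_fibers (S I T : finType) (G : pred S) (f : S -> {ffun I -> T})
    (c : I -> T -> R) (M b Q : R) : 0 <= Q ->
  (forall s, G s -> \sum_i c i (f s i) <= M) ->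
  \prod_i \sum_t expR (- c i t) <= expR b ->
  (forall v, (#|[pred s | G s & f s == v]|)%:R <= Q) ->
  #|G|%:R <= Q * expR (M + b).
Proof.
move=> Q0 GM cb fQ.
apply: (@le_trans _ _ (\sum_(s | G s) expR (M - \sum_i c i (f s i)))).
  rewrite -sum1_card natr_sum; apply: ler_sum => s Gs.
  by rewrite -expR0 ler_expR subr_ge0 GM.
rewrite (partition_big f predT) //=.
apply: (@le_trans _ _ (\sum_(v : {ffun I -> T}) Q * expR (M - \sum_i c i (v i)))).
  apply: ler_sum => v _.
  rewrite (eq_bigr (fun=> expR (M - \sum_i c i (v i)))) => [|s /andP[_ /eqP ->]] //.
  by rewrite sumr_const -[leLHS]mulr_natl ler_wpM2r ?expR_ge0 ?fQ.
rewrite -mulr_sumr expRD ler_wpM2l //.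
under eq_bigr do rewrite expRD -sumrN expR_sum.
rewrite -mulr_sumr ler_wpM2l ?expR_ge0 // -(bigA_distr_bigA (fun i t => expR (- c i t))).
exact: cb.
Qed.

Definition hamming n (e e' : {ffun 'I_n -> bool}) : nat :=
  \sum_i (e i != e' i).

Lemma expRN1_le : expR (-1) <= 2^-1 :> R.
Proof.
rewrite expRN lef_pV2 ?posrE ?expR_gt0 //.
by have := expR_ge1Dx (1 : R).
Qed.

Lemma expRNn_le k : expR (- k%:R) <= 2^-1 ^+ k :> R.
Proof.
rewrite -mulN1r expRM_natr.
by rewrite lerXn2r ?nnegrE ?expR_ge0 // expRN1_le.
Qed.

(* Chernoff's bound with weights [expR (-4 * distance)]. *)
Lemma card_hamming_ball n (e0 : {ffun 'I_n -> bool}) (F : pred {ffun 'I_n -> bool}) :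
  (forall e, F e -> (64 * hamming e0 e <= n)%N) ->
  #|F|%:R <= expR (n%:R / 8) :> R.
Proof.
move=> Fn.
apply: (@le_trans _ _ (\sum_e expR (n%:R / 16 - 4 * (hamming e0 e)%:R))).
  rewrite -sum1_card natr_sum big_mkcond; apply: ler_sum => e _.
  case: ifP => [Fe|_]; last exact: expR_ge0.
  rewrite -[leLHS]expR0 ler_expR subr_ge0.
  have := Fn e Fe; rewrite -(ler_nat R) natrM => h; lra.
under eq_bigr => e _.
  rewrite expRD /hamming natr_sum mulr_sumr -sumrN expR_sum.
  over.
rewrite -mulr_sumr.
rewrite -(bigA_distr_bigA (fun i b => expR (- (4 * (e0 i != b)%:R)))) /=.
have -> : n%:R / 8 = n%:R / 16 + n%:R / 16 :> R by field.
rewrite expRD ler_wpM2l ?expR_ge0 //.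
have -> : expR (n%:R / 16) = \prod_(i < n) expR 16^-1 :> R.
  by rewrite prodr_const card_ord -expRM_natl.
apply: ler_prod => i _; rewrite big_bool /= addr_ge0 ?expR_ge0 //=.
have e4 : expR (- 4) <= 16^-1 :> R.
  by apply: le_trans (expRNn_le 4) _; lra.
have := expR_ge1Dx (16^-1 : R).
by case: (e0 i); rewrite /= ?mulr0 ?mulr1 oppr0 expR0; lra.
Qed.

End EntropyMethod.

(** * Rounding to cells and the cost of encoding a cell *)

Section Cells.
Context {R : realType}.

(* The sign is recorded by [s <= - D], so that all [s] with [`|s| < D] share the
   cell [(false, ord0)]; the second component is junk when the quotient exceeds
   [B]. *)
Definition cell (D : R) B (s : R) : bool * 'I_B.+1 :=
  (s <= - D, inord (Num.truncn (`|s| / D))).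

(* The central cell is free; the other ones pay [eta^-1] up front, which makes
   their total weight [O(eta)]. *)
Definition cell_cost B (eta : R) (z : bool * 'I_B.+1) : R :=
  if z == (false, ord0) then 0 else z.2%:R + eta^-1.

(** The central cell weighs 1. The others weigh at most [expR (- eta^-1) <= eta] times a geometric
    series of sum at most 2, once for each sign; hence [1 + 4 * eta] in all, uniformly in [B]. *)
Lemma sum_expR_cell_cost B (eta : R) : 0 < eta ->
  \sum_z expR (- @cell_cost B eta z) <= expR (4 * eta).
Proof.
move=> eta0.
have geo k : \sum_(i < k) 2^-1 ^+ i = 2 - 2 * 2^-1 ^+ k :> R.
  elim: k => [|k IH]; first by rewrite big_ord0 expr0; lra.
  by rewrite big_ord_recr /= IH exprS; field.
apply: (@le_trans _ _ (\sum_z ((z == (false, ord0) :> bool * 'I_B.+1)%:R +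
    eta * 2^-1 ^+ z.2))).
  apply: ler_sum => z _; rewrite /cell_cost; case: ifP => _ /=.
    by rewrite oppr0 expR0 lerDl mulr_ge0 ?exprn_ge0 ?invr_ge0 ?(ltW eta0).
  rewrite add0r opprD expRD mulrC.
  apply: ler_pM; [exact: expR_ge0|exact: expR_ge0| |exact: expRNn_le].
  rewrite expRN invf_ple ?posrE ?expR_gt0 //.
  by apply: le_trans (expR_ge1Dx _); rewrite lerDr.
rewrite big_split /= (bigD1 (false, ord0)) //= big1 => [|z /negPf -> //].
rewrite -mulr_sumr -(pair_bigA _ (fun (b : bool) (k : 'I_B.+1) => 2^-1 ^+ k)) /=.
rewrite big_bool /= geo addr0.
apply: le_trans (expR_ge1Dx _); rewrite lerD2l [leRHS]mulrC ler_pM2l //.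
have : 0 <= 2^-1 ^+ B.+1 :> R by rewrite exprn_ge0 ?invr_ge0.
by lra.
Qed.

(** Outside the central cell the quotient is at least 1, so raising it to the powers [p] and [2 * p]
    loses nothing; these moments are controlled by Khintchine's inequality. *)
Lemma cell_cost_le (D eta p s : R) B : 0 < D -> 0 < eta -> 1 <= p ->
  (Num.truncn (`|s| / D) <= B)%N ->
  @cell_cost B eta (cell D B s) <=
    (`|s| / D) `^ p + eta^-1 * (`|s| / D) `^ (2 * p).
Proof.
move=> D0 eta0 p1 sB; set y := `|s| / D.
have y0 : 0 <= y by rewrite divr_ge0 ?(ltW D0).
have rhs0 : 0 <= y `^ p + eta^-1 * y `^ (2 * p).
  by rewrite addr_ge0 ?powR_ge0 // mulr_ge0 ?powR_ge0 // invr_ge0 ltW.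
rewrite /cell_cost; case: ifPn => //; rewrite xpair_eqE negb_and => h.
have y1 : 1 <= y.
  case/orP: h => [|h].
    rewrite eqbF_neg negbK => sD; rewrite /y ler_pdivlMr // mul1r.
    by have := ler_norm (- s); rewrite normrN; lra.
  rewrite -truncn_gt0 lt0n; apply: contra h => /eqP h.
  by apply/eqP/val_inj; rewrite /= -/y h inordK.
rewrite /= inordK // -/y; apply: lerD.
  by apply: le_trans (le1r_powR y1 p1); rewrite truncn_le.
rewrite ler_peMr ?invr_ge0 ?(ltW eta0) //.
by apply: le_trans y1 (le1r_powR y1 _); lra.
Qed.

(** The central cell is the interval ]-D, D[, of length [2 * D]; any other cell fixes the sign and
    confines the absolute value to an interval of length [D]. *)
Lemma cell_eq_dist (D s s' : R) B : 0 < D ->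
  (Num.truncn (`|s| / D) <= B)%N -> (Num.truncn (`|s'| / D) <= B)%N ->
  cell D B s = cell D B s' -> `|s - s'| <= 2 * D.
Proof.
move=> D0 sB s'B [sE /(congr1 val)]; rewrite /= !inordK // => kE.
have itv (u : R) : (Num.truncn (`|u| / D))%:R * D <= `|u| < (Num.truncn (`|u| / D))%:R * D + D.
  have := truncn_itv (divr_ge0 (normr_ge0 u) (ltW D0)).
  by rewrite ler_pdivlMr // ltr_pdivrMr // -natr1 mulrDl mul1r.
have := itv s'; rewrite -kE; have := itv s.
set k := Num.truncn _ => /andP[s1 s2] /andP[s'1 s'2].
rewrite ler_norml.
have [k0|k0] := posnP k.
  move: s2 s'2; rewrite k0 mul0r add0r !ltr_norml => /andP[? ?] /andP[? ?].
  by apply/andP; split; lra.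
have kD : D <= k%:R * D by rewrite ler_peMl ?(ltW D0) // ler1n.
move: sE; case: (leP s (- D)) => sD; case: (leP s' (- D)) => // s'D _.
  by move: s1 s2 s'1 s'2; rewrite !ler0_norm; [move=> *; apply/andP; split; lra|lra|lra].
have sp (u : R) : - D < u -> k%:R * D <= `|u| -> 0 <= u.
  move=> uD; case: (ger0P u) => // u0; lra.
by move: s1 s2 s'1 s'2 (sp _ sD s1) (sp _ s'D s'1) => + + + + s0 s'0;
  rewrite !ger0_norm // => *; apply/andP; split; lra.
Qed.

End Cells.

(** * Partial colouring *)

Section PartialColoring.
Context {R : realType}.

(** At least half of all sign vectors have small cost and small p-th power sum. Were any two of them
    in a common cell at distance at most [n / 64], each cell would hold at most [expR (n / 8)] of
    them, too few for the number of cells that the cost allows. *)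
Lemma exists_distant_pair n m (p d : R) (X : 'M[R]_(n, m)) (D : R) :
  2 <= p -> (4 < n)%N -> 0 < D ->
  d = (64 * (khintchine_const p + khintchine_const (2 * p) + 1))^-1 ->
  D `^ p = d^-1 * n%:R `^ (p / 2 - 1) ->
  (forall i, lpnorm p%:E (row i X) <= 1) ->
  let S e j := sign_sum e (fun i => X i j) in
  exists e e', [/\ (n < 64 * hamming e e')%N,
    forall j, `|S e j - S e' j| <= 2 * D,
    \sum_j `|S e j| `^ p <= 4 * (khintchine_const p * n%:R `^ (p / 2)) &
    \sum_j `|S e' j| `^ p <= 4 * (khintchine_const p * n%:R `^ (p / 2))].
Proof.
move=> p2 n4 D0; set K1 := khintchine_const p; set K2 := khintchine_const (2 * p).
move=> dE DE X1 S.
have p0 : 0 < p by lra.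
have p20 : 0 < 2 * p by lra.
have K10 : 0 < K1 by exact: khintchine_const_gt0.
have K20 : 0 < K2 by exact: khintchine_const_gt0.
have d0 : 0 < d by rewrite dE invr_gt0; lra.
have n0 : 0 < n%:R :> R by rewrite ltr0n; lia.
pose al j := \sum_i `|X i j| `^ p.
have al0 j : 0 <= al j by apply: sumr_ge0 => i _; exact: powR_ge0.
have alS : \sum_j al j <= n%:R.
  rewrite exchange_big /=.
  have -> : n%:R = \sum_(i < n) 1 :> R by rewrite sumr_const card_ord.
  apply: ler_sum => i _; have := ler_powR2 (ltW p0) (lpnorm_ge0 _ _) (X1 i).
  rewrite powR1 lpnorm_powR // (eq_bigr (fun j => `|X i j| `^ p)) // => j _.
  by rewrite mxE.
(* The summand [n / m] only serves to make [eta] positive on zero columns. *)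
pose eta (j : 'I_m) := d * (al j + n%:R / m%:R).
have eta0 j : 0 < eta j.
  rewrite mulr_gt0 // ltr_wpDl // divr_gt0 // ltr0n.
  exact: leq_ltn_trans (ltn_ord j).
have etaS : \sum_j eta j <= 2 * d * n%:R.
  rewrite -mulr_sumr big_split /= sumr_const card_ord [2 * d]mulrC -mulrA ler_pM2l //.
  have nm : (n%:R / m%:R) *+ m <= n%:R :> R.
    rewrite -mulr_natr; have [->|mN0] := eqVneq (m%:R : R) 0; first by rewrite mulr0 ltW.
    by rewrite divfK.
  by lra.
(* The power of [n] in [DE] cancels the one from [sum_sqr_powR_le], leaving [d * al j]. *)
have DpE j : (\sum_i X i j ^+ 2) `^ (p / 2) / D `^ p <= eta j.
  rewrite ler_pdivrMr ?powR_gt0 //; apply: le_trans (sum_sqr_powR_le _ p0) _.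
  have -> : Num.max 1 (p / 2) = p / 2 by apply/max_idPr; lra.
  rewrite DE /eta mulrCA mulrA mulrA mulVf ?gt_eqF // mul1r mulrC.
  by rewrite -/(al j) ler_wpM2r ?powR_ge0 // lerDl divr_ge0.
(* Any common bound of the quotients would do: [B] makes the set of cells finite and enters no
   estimate. *)
pose B := (\sum_(e : {ffun 'I_n -> bool}) \sum_j Num.truncn (`|S e j| / D))%N.
have SB e j : (Num.truncn (`|S e j| / D) <= B)%N.
  rewrite /B (bigD1 e) //= (bigD1 j) //=.
  exact: leq_trans (leq_addr _ _) (leq_addr _ _).
pose f (e : {ffun 'I_n -> bool}) := [ffun j => cell D B (S e j)].
pose c j z := @cell_cost R B (eta j) z.
pose cost e := \sum_j c j (f e j).
pose Sp e := \sum_j `|S e j| `^ p.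
pose N2 : R := 2 ^+ n.
have N20 : 0 < N2 by exact: exprn_gt0.
(* The factor [(eta j)^-1] is harmless: it meets a [2 * p]-th moment of order [eta j ^+ 2]. *)
have cost_avg : \sum_e cost e <= N2 * (2 * (K1 + K2) * d * n%:R).
  rewrite exchange_big /=.
  apply: (@le_trans _ _ (\sum_j N2 * ((K1 + K2) * eta j))); last first.
    rewrite -mulr_sumr -mulr_sumr ler_pM2l //.
    have -> : 2 * (K1 + K2) * d * n%:R = (K1 + K2) * (2 * d * n%:R) by ring.
    by rewrite ler_pM2l // addr_gt0.
  apply: ler_sum => j _; set V := \sum_i X i j ^+ 2.
  have k1 : \sum_(e : {ffun 'I_n -> bool}) `|S e j| `^ p <= N2 * (K1 * V `^ (p / 2)).
    exact: khintchine.
  have k2 : \sum_(e : {ffun 'I_n -> bool}) `|S e j| `^ (2 * p) <=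
      N2 * (K2 * (V `^ (p / 2)) ^+ 2).
    rewrite -(powR_mulrn 2 (powR_ge0 V (p / 2))) -powRrM.
    have -> : p / 2 * 2 = 2 * p / 2 by field.
    exact: khintchine.
  set v := V `^ (p / 2) in k1 k2; have v0 : 0 <= v by exact: powR_ge0.
  set E := D `^ p; have E0 : 0 < E by exact: powR_gt0.
  have vE : v / E <= eta j by exact: DpE.
  have vE0 : 0 <= v / E by rewrite divr_ge0 // ltW.
  apply: (@le_trans _ _ (\sum_(e : {ffun 'I_n -> bool})
     (E^-1 * `|S e j| `^ p + (eta j)^-1 * (E^-1 ^+ 2 * `|S e j| `^ (2 * p))))).
    apply: ler_sum => e _; rewrite /c ffunE.
    have p1 : 1 <= p by lra.
    apply: le_trans (cell_cost_le D0 (eta0 j) p1 (SB e j)) _.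
    rewrite !powRM ?invr_ge0 ?(ltW D0) // !invr_powR ?(ltW D0) // -/E.
    have -> : D `^ (2 * p) = E ^+ 2.
      by rewrite mulrC powRrM powR_mulrn ?powR_ge0.
    by rewrite exprVn [X in X + _]mulrC [_ `^ (2 * p) * _]mulrC.
  rewrite big_split /= -!mulr_sumr.
  have t1 : E^-1 * \sum_(e : {ffun 'I_n -> bool}) `|S e j| `^ p <= N2 * (K1 * eta j).
    apply: (@le_trans _ _ (N2 * (K1 * (v / E)))); last by rewrite !ler_pM2l.
    rewrite mulrC ler_pdivrMr //.
    by have -> : N2 * (K1 * (v / E)) * E = N2 * (K1 * v) by field; rewrite gt_eqF.
  have t2 : (eta j)^-1 * (E^-1 ^+ 2 * \sum_(e : {ffun 'I_n -> bool}) `|S e j| `^ (2 * p)) <=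
      N2 * (K2 * eta j).
    rewrite mulrC ler_pdivrMr //.
    apply: (@le_trans _ _ (N2 * (K2 * (v / E) ^+ 2))).
      rewrite mulrC exprVn ler_pdivrMr ?exprn_gt0 //.
      have -> : N2 * (K2 * (v / E) ^+ 2) * E ^+ 2 = N2 * (K2 * v ^+ 2).
        by field; rewrite gt_eqF.
      exact: k2.
    have -> : N2 * (K2 * eta j) * eta j = N2 * (K2 * eta j ^+ 2) by ring.
    by rewrite !ler_pM2l // lerXn2r ?nnegrE // ltW.
  by lra.
have Sp_avg : \sum_e Sp e <= N2 * (K1 * n%:R `^ (p / 2)).
  apply: le_trans (sum_sign_powR_le p0 X1) _.
  by have -> : Num.max 1 (p / 2) = p / 2 by apply/max_idPr; lra.
pose M := 2 * (K1 + K2) * d * n%:R; pose P := K1 * n%:R `^ (p / 2).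
have M0 : 0 < M by rewrite !mulr_gt0 // addr_gt0.
have P0 : 0 < P by rewrite mulr_gt0 // powR_gt0.
pose G : pred {ffun 'I_n -> bool} := fun e => (cost e <= 4 * M) && (Sp e <= 4 * P).
have cost0 e : 0 <= cost e.
  apply: sumr_ge0 => j _; rewrite /c /cell_cost; case: ifP => // _.
  by rewrite addr_ge0 // invr_ge0 ltW.
have Sp0 e : 0 <= Sp e by apply: sumr_ge0 => j _; exact: powR_ge0.
have M4 : 0 < 4 * M by rewrite mulr_gt0.
have P4 : 0 < 4 * P by rewrite mulr_gt0.
(* Markov's inequality for [cost] and [Sp] together. *)
have cardG : N2 / 2 <= #|G|%:R.
  have : \sum_(e : {ffun 'I_n -> bool}) (1 : R) <=
      \sum_(e : {ffun 'I_n -> bool}) ((G e)%:R + cost e / (4 * M) + Sp e / (4 * P)).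
    apply: ler_sum => e _.
    have q1 : 0 <= cost e / (4 * M) by rewrite divr_ge0 // mulr_ge0 // ltW.
    have q2 : 0 <= Sp e / (4 * P) by rewrite divr_ge0 // mulr_ge0 // ltW.
    case: (boolP (G e)) => [_|]; first by rewrite /=; lra.
    rewrite /G negb_and -!ltNge => /orP[h|h].
      suff : 1 <= cost e / (4 * M) by rewrite /=; lra.
      by rewrite (ler_pdivlMr _ _ M4) mul1r ltW.
    suff : 1 <= Sp e / (4 * P) by rewrite /=; lra.
    by rewrite (ler_pdivlMr _ _ P4) mul1r ltW.
  rewrite sumr_const card_ffun card_bool card_ord natrX -/N2 !big_split /=.
  rewrite -!mulr_suml -natr_sum.
  have -> : (\sum_e G e)%N = #|G|.
    by rewrite -sum1_card [RHS]big_mkcond; apply: eq_bigr => e _; rewrite /in_mem /=; case: (G e).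
  have s1 : (\sum_e cost e) / (4 * M) <= N2 / 4.
    rewrite (ler_pdivrMr _ _ M4).
    by have -> : N2 / 4 * (4 * M) = N2 * M by field.
  have s2 : (\sum_e Sp e) / (4 * P) <= N2 / 4.
    rewrite (ler_pdivrMr _ _ P4).
    by have -> : N2 / 4 * (4 * P) = N2 * P by field.
  by lra.
have [[e [e' [Ge Ge' fE he]]]|none] := pselect (exists e e', [/\ G e, G e', f e = f e' &
    (n < 64 * hamming e e')%N]).
  move: Ge Ge' => /andP[_ Ge] /andP[_ Ge']; exists e, e'; split=> // j.
  apply: (cell_eq_dist D0 (SB e j) (SB e' j)).
  by move/ffunP/(_ j): fE; rewrite !ffunE.
have fib v : #|[pred e | G e & f e == v]|%:R <= expR (n%:R / 8) :> R.
  case: (pickP [pred e | G e & f e == v]) => [e0 /andP[Ge0 /eqP fe0]|h]; last first.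
    by rewrite (eq_card0 h) expR_ge0.
  apply: (card_hamming_ball (e0 := e0)) => e /andP[Ge /eqP fe].
  rewrite leqNgt; apply/negP => h; apply: none; exists e0, e; split=> //.
  by rewrite fe fe0.
have prodc : \prod_j \sum_z expR (- c j z) <= expR (8 * d * n%:R).
  apply: (@le_trans _ _ (\prod_j expR (4 * eta j))).
    apply: ler_prod => j _; rewrite sum_expR_cell_cost // andbT.
    by apply: sumr_ge0 => z _; exact: expR_ge0.
  by rewrite -expR_sum -mulr_sumr ler_expR; move: etaS; lra.
have Gcost e : G e -> \sum_j c j (f e j) <= 4 * M by case/andP.
have := card_le_fibers (expR_ge0 _) Gcost prodc fib.
rewrite -expRD => h; exfalso.
(* The exponent is [n / 8] from the fibres plus [4 * M + 8 * d * n], and [d] is chosen to make the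
   latter at most [n / 8]. *)
have h2 : N2 / 2 <= expR (n%:R / 4).
  apply: le_trans cardG _; apply: le_trans h _; rewrite ler_expR /M.
  suff : d * (8 * (K1 + K2) + 8) <= 8^-1.
    move=> /(ler_wpM2r (ltW n0)); lra.
  rewrite dE ler_pdivrMl; last by lra.
  by lra.
have e2 : expR (2^-1) <= 2 :> R.
  have := expR_ge1Dx (- 2^-1 : R); rewrite expRN => h3.
  rewrite -[leRHS]invrK -[leLHS]invrK lef_pV2 ?posrE ?invr_gt0 ?expR_gt0 //.
  by lra.
have h4 : expR (n%:R / 4) ^+ 2 <= N2.
  rewrite -expRM_natl /N2.
  have -> : 2 * (n%:R / 4) = n%:R * 2^-1 :> R by field.
  by rewrite expRM_natl lerXn2r ?nnegrE ?expR_ge0.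
(* With [x = expR (n / 4)], [x ^+ 2 <= N2 <= 2 * x] forces [x <= 2], but [n >= 5] gives
   [x >= 1 + 5 / 4]. *)
have h5 : 2 < expR (n%:R / 4) :> R.
  apply: lt_le_trans (expR_ge1Dx _).
  have : 5%:R <= n%:R :> R by rewrite ler_nat.
  by lra.
by move: h2 h4 h5; set x := expR (n%:R / 4) => h2 h4 h5; nra.
Qed.

Lemma partial_coloring (p : R) : 2 <= p ->
  exists2 K : R, 1 <= K & forall n m (X : 'M[R]_(n, m)), (0 < n)%N ->
    (forall i, lpnorm p%:E (row i X) <= 1) ->
    exists t : 'rV[R]_n, [/\ n%:R <= K * lpnorm 1%:E t,
      lpnorm +oo%E (t *m X) <= K * n%:R `^ (2^-1 - p^-1) &
      lpnorm p%:E (t *m X) <= K * n%:R `^ 2^-1].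
Proof.
move=> p2; have p0 : 0 < p by lra.
set K1 := khintchine_const p; set K2 := khintchine_const (2 * p).
have K10 : 0 < K1 by exact: khintchine_const_gt0.
have K20 : 0 < K2 by apply: khintchine_const_gt0; lra.
have [d dE] : exists d, d = (64 * (K1 + K2 + 1))^-1 by exists (64 * (K1 + K2 + 1))^-1.
have d0 : 0 < d by rewrite dE invr_gt0; lra.
have a0 : 0 <= d^-1 `^ p^-1 by exact: powR_ge0.
have b0 : 0 <= (8 * K1) `^ p^-1 by exact: powR_ge0.
(* The three lower bounds on [K] serve the Hamming distance, the cell width and the p-th power sums,
   respectively. *)
have [K [K64 Kd KK1]] : exists K : R,
    [/\ 64 <= K, d^-1 `^ p^-1 <= K & (8 * K1) `^ p^-1 <= K].
  by exists (64 + d^-1 `^ p^-1 + (8 * K1) `^ p^-1); split; lra.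
have K0 : 0 <= K by lra.
exists K => [|n m X n0 X1]; first by lra.
have nR : 1 <= n%:R :> R by rewrite ler1n.
have nR0 : 0 < n%:R :> R by rewrite ltr0n.
(* The entropy argument only works for [n > 4]. *)
have [n4|n4] := leqP n 4.
  pose i0 := Ordinal n0; exists (delta_mx ord0 i0); rewrite -rowE.
  have e1 : lpnorm 1%:E (delta_mx ord0 i0 : 'rV[R]_n) = 1.
    rewrite lpnorm1E (bigD1 i0) //= mxE !eqxx normr1 big1 ?addr0 // => j ji.
    by rewrite mxE (negPf ji) andbF normr0.
  have K1n (s : R) : 0 <= s -> 1 <= K * n%:R `^ s.
    move=> s0; apply: (@le_trans _ _ K); first by lra.
    by rewrite ler_peMr // -[leLHS](powRr0 n%:R); exact: ler_powR.
  split.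
  - rewrite e1 mulr1; apply: (@le_trans _ _ 4); first by rewrite ler_nat.
    by lra.
  - apply: le_trans (K1n _ _); last by rewrite subr_ge0 lef_pV2 ?posrE.
    apply: le_trans (X1 i0); apply: lpnorm_anti; rewrite ?leey // lee_fin; lra.
  - by apply: le_trans (X1 i0) _; apply: K1n; rewrite invr_ge0.
pose D := (d^-1 * n%:R `^ (p / 2 - 1)) `^ p^-1.
have Dp0 : 0 < d^-1 * n%:R `^ (p / 2 - 1).
  by apply: mulr_gt0; [rewrite invr_gt0|exact: powR_gt0].
have D0 : 0 < D by exact: powR_gt0.
have DE : D `^ p = d^-1 * n%:R `^ (p / 2 - 1).
  by rewrite /D powRVK ?gt_eqF // ltW.
have [e [e' [he eD eS e'S]]] := exists_distant_pair p2 n4 D0 dE DE X1.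
(* The entries are -1, 0 or 1, so the l_1 norm is the Hamming distance of [e] and [e']. *)
exists (2^-1 *: (sign_row e - sign_row e')).
have tX j : ((2^-1 *: (sign_row e - sign_row e')) *m X) ord0 j =
    2^-1 * (sign_sum e (fun i => X i j) - sign_sum e' (fun i => X i j)).
  by rewrite -scalemxAl mxE mulmxBl mxE [X in _ + X]mxE !mul_sign_row.
split.
- rewrite lpnorm1E (eq_bigr (fun i => (e i != e' i)%:R)) => [|i _]; last first.
    rewrite !mxE; case: (e i); case: (e' i);
      rewrite /= ?expr0 ?expr1 ?subrr ?mulr0 ?normr0 //.
      by rewrite ler0_norm; lra.
    by rewrite ger0_norm; lra.
  rewrite -natr_sum -/(hamming e e'); apply: (@le_trans _ _ (64 * (hamming e e')%:R)).
    by rewrite -natrM ler_nat ltnW.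
  by apply: ler_wpM2r K64.
- apply: (@le_trans _ _ D).
    apply: lpnormy_le => [|j]; first exact: ltW.
    rewrite tX normrM ger0_norm ?invr_ge0 // mulrC ler_pdivrMr // mulrC.
    exact: eD.
  have dV0 : 0 <= d^-1 by rewrite invr_ge0 ltW.
  rewrite /D powRM ?powR_ge0 // -powRrM.
  have -> : (p / 2 - 1) * p^-1 = 2^-1 - p^-1 by field; rewrite gt_eqF.
  by apply: ler_wpM2r Kd; exact: powR_ge0.
- have b1 : 0 <= 8 * K1 by lra.
  apply: lpnorm_le; [exact: p0|by rewrite mulr_ge0 ?powR_ge0|].
  apply: (@le_trans _ _ (8 * (K1 * n%:R `^ (p / 2)))); last first.
    rewrite powRM ?powR_ge0 // -powRrM mulrA [2^-1 * p]mulrC.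
    apply: ler_wpM2r; first exact: powR_ge0.
    rewrite -(powRVK (lt0r_neq0 p0) b1).
    by apply: ler_powR2; [exact: ltW|exact: powR_ge0|].
  apply: (@le_trans _ _ (\sum_j (`|sign_sum e (fun i => X i j)| `^ p +
      `|sign_sum e' (fun i => X i j)| `^ p))); last first.
    by rewrite big_split /=; move: eS e'S; rewrite -/K1; lra.
  apply: ler_sum => j _; rewrite tX.
  set s := sign_sum e _; set s' := sign_sum e' _.
  (* Bounding by the maximum gives the sum of both p-th powers without a factor depending on [p]. *)
  have h : `|2^-1 * (s - s')| <= Num.max `|s| `|s'|.
    have := ler_normB s s'; have m1 : `|s| <= Num.max `|s| `|s'| by rewrite le_max lexx.
    have m2 : `|s'| <= Num.max `|s| `|s'| by rewrite le_max lexx orbT.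
    by rewrite normrM ger0_norm ?invr_ge0 //; lra.
  apply: le_trans (ler_powR2 (ltW p0) (normr_ge0 _) h) _.
  by rewrite /Num.max; case: ifP => _; rewrite ?lerDl ?lerDr powR_ge0.
Qed.

End PartialColoring.

(** * Bounds for [Gamma] in the form needed by the four cases *)

Section LowerBounds.
Context {R : realType}.

(** The exponent [r] dominates both [p] and [q]: the l_p ball lies in the l_r ball, and the l_q norm
    of the signed sum is at most a power of [m] times its l_r norm. *)
Lemma le_Gamma_sign (p q : \bar R) (r : R) n m :
  (1%:E <= p)%E -> (1%:E <= q)%E -> (p <= r%:E)%E -> (q <= r%:E)%E ->
  (0 < n <= m)%N ->
  (((khintchine_const r `^ r^-1)^-1 *
    (n%:R `^ (1 - Num.max 1 (r / 2) / r) * m%:R `^ (r^-1 - invexp q)))%:E <=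
    Gamma n (@lpball R m p) (@lpball R m q))%E.
Proof.
move=> p1 q1 pr qr /andP[n0 nm].
have r1 : 1 <= r by rewrite -lee_fin; exact: le_trans pr.
have r0 : 0 < r by exact: lt_le_trans r1.
have nR : 0 < n%:R :> R by rewrite ltr0n.
have K0 := khintchine_const_gt0 r0.
have C0 : 0 < khintchine_const r `^ r^-1 by exact: powR_gt0.
set h := Num.max 1 (r / 2); set C := _ `^ r^-1 in C0 *.
apply: le_Gamma => // [|X X1].
  by rewrite mulr_ge0 ?mulr_ge0 ?powR_ge0 // invr_ge0 ltW.
have [|e eX] := @exists_sign_row _ n m r X r0.
  by move=> i; apply: le_trans (X1 i); exact: lpnorm_anti.
exists (sign_row e); rewrite ?lpnorm1_sign_row.
  apply/eqP => e0; have := lpnorm1_sign_row (R := R) e.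
  rewrite e0 -(scale0r (0 : 'rV_n)) lpnormZ // normr0 mul0r => /eqP.
  by rewrite lt_eqF.
have mR : 0 < m%:R :> R by rewrite ltr0n (leq_trans n0).
apply: le_trans (ler_wpM2l _ (lpnorm_le_dim _ q1 qr)) _.
  by rewrite mulr_ge0 ?mulr_ge0 ?powR_ge0 // invr_ge0 ltW.
rewrite invexpE // -/h in eX *.
apply: le_trans (ler_wpM2l _ (ler_wpM2l (powR_ge0 _ _) eX)) _.
  by rewrite mulr_ge0 ?mulr_ge0 ?powR_ge0 // invr_ge0 ltW.
rewrite powRM ?powR_ge0 ?(ltW K0) // -/C -powRrM.
have mm : m%:R `^ (r^-1 - invexp q) * m%:R `^ (invexp q - r^-1) = 1 :> R.
  rewrite -powRD ?(gt_eqF mR) ?implybT //.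
  have -> : r^-1 - invexp q + (invexp q - r^-1) = 0 by ring.
  by rewrite powRr0.
have nn : n%:R `^ (1 - h / r) * n%:R `^ (h / r) = n%:R :> R.
  by rewrite -powRD ?(gt_eqF nR) ?implybT // subrK powRr1 // ler0n.
set a := n%:R `^ _ in nn *; set b := n%:R `^ _ in nn *.
set u := m%:R `^ _ in mm *; set v := m%:R `^ _ in mm *.
have -> : C^-1 * (a * u) * (v * (C * b)) = a * b * (u * v).
  by field; rewrite gt_eqF.
by rewrite mm nn mulr1.
Qed.

(** For finite [q], [q - r] of the [q] factors of each entry are bounded by the maximum norm. *)
Lemma le_lpnorm_interpolation m (r : R) (q : \bar R) (y : 'rV[R]_m) (K n : R) :
  0 < r -> (r%:E <= q)%E -> 0 < K -> 0 < n ->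
  lpnorm +oo%E y <= K * n `^ (2^-1 - r^-1) ->
  lpnorm r%:E y <= K * n `^ 2^-1 ->
  lpnorm q y <= K * n `^ (2^-1 - r^-1 + invexp q).
Proof.
move=> r0; case: q => [q| |] // rq K0 n0 yoo yr; last by rewrite invexpy addr0.
have {}rq : r <= q by rewrite -lee_fin.
have q0 : 0 < q by exact: lt_le_trans rq.
rewrite /invexp fine_invr.
apply: lpnorm_le => //; first by rewrite mulr_ge0 ?powR_ge0 ?ltW.
set A := K * _ in yoo.
have A0 : 0 < A by rewrite mulr_gt0 ?powR_gt0.
apply: (@le_trans _ _ (\sum_i `|y ord0 i| `^ r * A `^ (q - r))).
  apply: ler_sum => i _.
  have -> : `|y ord0 i| `^ q = `|y ord0 i| `^ r * `|y ord0 i| `^ (q - r).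
    by rewrite -powRD ?[r + _]addrC ?subrK // (gt_eqF q0).
  apply: ler_wpM2l; first exact: powR_ge0.
  apply: ler_powR2; rewrite ?subr_ge0 //; apply: le_trans yoo.
  by apply: norm_le_lpnorm; rewrite leey.
rewrite -mulr_suml -lpnorm_powR //.
apply: (@le_trans _ _ ((K * n `^ 2^-1) `^ r * A `^ (q - r))).
  apply: ler_wpM2r; first exact: powR_ge0.
  by apply: ler_powR2 yr; [exact: ltW|exact: lpnorm_ge0].
rewrite /A !powRM ?powR_ge0 ?(ltW K0) // -!powRrM mulrACA.
rewrite -!powRD ?(gt_eqF K0) ?(gt_eqF n0) ?implybT //.
have -> : r + (q - r) = q by ring.
have -> : 2^-1 * r + (2^-1 - r^-1) * (q - r) = (2^-1 - r^-1 + q^-1) * q.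
  by field; rewrite !gt_eqF.
exact: lexx.
Qed.

(** One factor [K^-1] pays for the l_1 norm of [t] falling short of [n], the other for the
    interpolated l_q norm of its image. *)
Lemma le_Gamma_partial_coloring (p q : \bar R) (r : R) :
  (1%:E <= p)%E -> 2 <= r -> (p <= r%:E)%E -> (r%:E <= q)%E ->
  exists2 c : R, 0 < c & forall n m, (0 < n)%N ->
    ((c * n%:R `^ (2^-1 + r^-1 - invexp q))%:E <=
      Gamma n (@lpball R m p) (@lpball R m q))%E.
Proof.
move=> p1 r2 pr rq; have [K K1 H] := partial_coloring r2.
have r0 : 0 < r by exact: lt_le_trans r2.
have K0 : 0 < K by exact: lt_le_trans K1.
have q1 : (1%:E <= q)%E by apply: le_trans rq; rewrite lee_fin (le_trans _ r2) // ler1n.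
exists (K^-1 * K^-1) => [|n m n0]; first by rewrite mulr_gt0 ?invr_gt0.
have nR : 0 < n%:R :> R by rewrite ltr0n.
apply: le_Gamma => // [|X X1].
  by rewrite mulr_ge0 ?powR_ge0 // mulr_ge0 ?invr_ge0 ?ltW.
have [|t [tn too tr]] := H n m X n0.
  by move=> i; apply: le_trans (X1 i); exact: lpnorm_anti.
exists t.
  apply/eqP => t0; move: tn; rewrite t0 -(scale0r (0 : 'rV_n)) lpnormZ //.
  by rewrite normr0 mul0r mulr0 leNgt nR.
apply: le_trans (ler_wpM2l _ (le_lpnorm_interpolation r0 rq K0 nR too tr)) _.
  by rewrite mulr_ge0 ?powR_ge0 // mulr_ge0 ?invr_ge0 ?ltW.
have nn : n%:R `^ (2^-1 + r^-1 - invexp q) * n%:R `^ (2^-1 - r^-1 + invexp q) = n%:R :> R.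
  rewrite -powRD ?(gt_eqF nR) ?implybT //.
  have -> : 2^-1 + r^-1 - invexp q + (2^-1 - r^-1 + invexp q) = 1 by lra.
  by rewrite powRr1 // ler0n.
set a := n%:R `^ _ in nn *; set b := n%:R `^ _ in nn *.
have -> : K^-1 * K^-1 * a * (K * b) = K^-1 * (a * b) by field; rewrite gt_eqF.
by rewrite nn ler_pdivrMl.
Qed.

Lemma Gamma_le_blocks (p q : R) n m : 1 <= q -> q <= p -> (0 < n <= m)%N ->
  (Gamma n (@lpball R m p%:E) (@lpball R m q%:E) <=
    (2 `^ (q^-1 - p^-1) * (n%:R `^ (1 - p^-1) * m%:R `^ (p^-1 - q^-1)))%:E)%E.
Proof.
move=> q1 qp /andP[n0 nm]; have p1 : 1 <= p by exact: le_trans qp.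
have k0 : (0 < m %/ n)%N by rewrite divn_gt0.
apply: le_trans (Gamma_le_block k0 _ p1 q1) _; first by rewrite mulnC leq_trunc_div.
rewrite lee_fin; set k := (m %/ n)%N in k0 *.
have nR : 0 < n%:R :> R by rewrite ltr0n.
have kR : 0 < k%:R :> R by rewrite ltr0n.
have mR : 0 < m%:R :> R by rewrite ltr0n (leq_trans n0).
pose e := q^-1 - p^-1.
have e0 : 0 <= e by rewrite subr_ge0 lef_pV2 // posrE ?(lt_le_trans ltr01).
have -> : p^-1 - q^-1 = - e by rewrite opprB.
have -> : 1 - p^-1 = 1 - q^-1 + e by rewrite /e; ring.
rewrite -/e !powRN [n%:R `^ (_ + e)]powRD ?(gt_eqF nR) ?implybT //.
(* With [k] the integer part of [m / n], [k >= 1] implies [m < n * (k + 1) <= 2 * n * k]. *)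
have mk : m%:R `^ e <= 2 `^ e * n%:R `^ e * k%:R `^ e.
  rewrite -!powRM ?mulr_ge0 ?ler0n //; apply: ler_powR2; rewrite ?ler0n //.
  rewrite -!natrM ler_nat; have := ltn_ceil m n0; rewrite -/k => h.
  by nia.
rewrite -[X in 2 `^ e * X]mulrA mulrCA; apply: ler_wpM2l; first exact: powR_ge0.
rewrite mulrA ler_pdivlMr ?powR_gt0 // mulrC ler_pdivrMr ?powR_gt0 //.
Qed.

End LowerBounds.

Unset Implicit Arguments.

Theorem theorem4p11 (R : realType) (p q : \bar R)
    (hp : (1%:E <= p)%E) (hq : (1%:E <= q)%E) :
  [/\ ((2%:E <= q)%E -> (q <= p)%E -> (p < +oo)%E ->
        equiv_nm (fun n m => Gamma n (@lpball R m p) (@lpball R m q))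
          (fun n m => n%:R `^ (2^-1) * m%:R `^ (invexp p - invexp q))),
      ((q <= p)%E -> (p <= 2%:E)%E ->
        equiv_nm (fun n m => Gamma n (@lpball R m p) (@lpball R m q))
          (fun n m => n%:R `^ (1 - invexp p) * m%:R `^ (invexp p - invexp q))),
      ((p <= q)%E -> (p <= 2%:E)%E ->
        equiv_nm (fun n m => Gamma n (@lpball R m p) (@lpball R m q))
          (fun n _ => n%:R `^ (1 - invexp q))) &
      ((p <= q)%E -> (2%:E < p)%E -> (p < +oo)%E ->
        equiv_nm (fun n m => Gamma n (@lpball R m p) (@lpball R m q))
          (fun n _ => n%:R `^ (2^-1 + invexp p - invexp q)))].
Proof.
have sign0 (r : R) : 1 <= r -> 0 < (khintchine_const r `^ r^-1)^-1.
  move=> r1; rewrite invr_gt0 powR_gt0 // khintchine_const_gt0 //.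
  exact: lt_le_trans r1.
have max2 (r : R) : 2 <= r -> 1 - Num.max 1 (r / 2) / r = 2^-1.
  move=> r2; have -> : Num.max 1 (r / 2) = r / 2 by apply/max_idPr; lra.
  by field; rewrite gt_eqF // (lt_le_trans _ r2).
have max1 (r : R) : r <= 2 -> 1 - Num.max 1 (r / 2) / r = 1 - r^-1.
  move=> r2; have -> : Num.max 1 (r / 2) = 1 by apply/max_idPl; lra.
  by rewrite mul1r.
split.
(* Signs with [r = p >= 2], against cosines in the full dimension [N = m]. *)
- case: p hp => [p| |] // p1 q2 qp _; have p1' : 1 <= p by rewrite -lee_fin.
  have p2 : 2 <= p by rewrite -lee_fin; exact: le_trans qp.
  exists (khintchine_const p `^ p^-1)^-1, 2; split=> [||n m n0 nm]; rewrite ?sign0 //.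
  rewrite invexpE //; split; first by rewrite -(max2 _ p2); apply: le_Gamma_sign; rewrite ?n0.
  by apply: Gamma_le_dct; rewrite ?nm ?leqnn.
(* Signs with [r = p <= 2], against blocks. *)
- case: p hp => [p| |] // p1 qp p2; case: q hq qp => [q| |] // q1 qp.
  have p1' : 1 <= p by rewrite -lee_fin.
  exists (khintchine_const p `^ p^-1)^-1, (2 `^ (q^-1 - p^-1)).
  split=> [||n m n0 nm]; rewrite ?sign0 ?powR_gt0 //.
  rewrite !invexpE //; split.
    by rewrite -max1 // -(invexpE q1); apply: le_Gamma_sign; rewrite ?n0.
  by apply: Gamma_le_blocks; rewrite ?n0.
- move=> pq p2.
  (* For [q <= 2], signs with [r = q] make the power of [m] disappear; for [q > 2], partial
     colouring is used with [r = 2]. *)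
  have [q2|q2] := leP q 2%:E.
    case: q hq pq q2 => [q| |] // q1 pq q2; have q1' : 1 <= q by rewrite -lee_fin.
    exists (khintchine_const q `^ q^-1)^-1, 1; split=> [||n m n0 nm]; rewrite ?sign0 //.
    rewrite mul1r; split; last exact: Gamma_le_identity.
    have := @le_Gamma_sign _ p q%:E q n m hp q1 pq (lexx _).
    by rewrite n0 nm invexpE // subrr powRr0 mulr1 max1 //; exact.
  have [c c0 H] := le_Gamma_partial_coloring hp (lexx 2) p2 (ltW q2).
  exists c, 1; split=> // n m n0 nm; rewrite mul1r; split.
    by have := H n m n0; have -> : 2^-1 + 2^-1 = 1 :> R by field.
  exact: Gamma_le_identity.
(* Partial colouring with [r = p], against cosines in dimension [N = n], which keeps the upper bound
   independent of [m]. *)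
- case: p hp => [p| |] // p1 pq p2 _; have p1' : 1 <= p by rewrite -lee_fin.
  have p2' : 2 <= p by rewrite ltW // -lte_fin.
  have [c c0 H] := le_Gamma_partial_coloring p1 p2' (lexx _) pq.
  exists c, 2; split=> // n m n0 nm; rewrite invexpE //; split; first exact: H.
  have nR : 0 < n%:R :> R by rewrite ltr0n.
  have -> : 2^-1 + p^-1 - invexp q = 2^-1 + (p^-1 - invexp q) by rewrite addrA.
  rewrite powRD ?(gt_eqF nR) ?implybT //.
  by apply: Gamma_le_dct => //; rewrite ?leqnn // (le_trans (ltW p2)).
Qed.
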